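(* Let $\rho:\{\lambda\in\mathbb{C}:0<|\lambda|<\ell\}\to\mathbb{C}$ be the injection-locking activation function defined in the context. Fix integers $i_0>0$ and $k_0>0$ and a number $R>0$, let $\overline B_R\subset\mathbb{C}^{i_0}$ be the closed Euclidean ball of radius $R$ centered at the origin, and let $f:\overline B_R\to\mathbb{C}^{k_0}$ be an arbitrary continuous function. Let $\epsilon>0$. There exist an integer $j_0>0$ and numbers $a_{ji},b_j,c_{kj}\in\mathbb{C}$, $j=1,\dots,j_0$, $i=1,\dots,i_0$, $k=1,\dots,k_0$, such that the following holds: (i) The inequalities $$0<\Big|\sum_{i=1}^{i_0}a_{ji}\lambda_i+b_j\Big|<\ell\quad\text{for every } j=1,2,\dots,j_0$$ hold for almost every $(\lambda_i)_{i=1}^{i_0}\in\overline B_R$ (with respect to the $2i_0$-dimensional Lebesgue measure on $\mathbb{C}^{i_0}=\mathbb{R}^{2i_0}$), and (ii) the function $\mathcal M=(\mathcal M_1,\dots,\mathcal M_{k_0})$ defined almost everywhere in $\overline B_R$ by $$\mathcal M_k\big((\lambda_i)_{i=1}^{i_0}\big)=\sum_{j=1}^{j_0}c_{kj}\,\rho\Big(\sum_{i=1}^{i_0}a_{ji}\lambda_i+b_j\Big),\qquad k=1,\dots,k_0,$$ is measurable and satisfies $$\|\mathcal M-f\|_{L^\infty(\overline B_R;\mathbb{C}^{k_0})}\le\epsilon.$$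
   Context: Fixed real parameters: $\kappa,\gamma,\delta\in(0,\infty)$, $\alpha\in\mathbb{R}$, $\mu>1$. For $z=(z_1,z_2)\in\mathbb{C}^2$ define $$X(z):=\begin{bmatrix}1-(z_1-z_2)&0\\0&1-(z_1+z_2)\end{bmatrix},\qquad Y(z):=\begin{bmatrix}1+|z|^2&|z_2|^2-|z_1|^2\\ |z_2|^2-|z_1|^2&\delta+|z|^2\end{bmatrix}.$$ For a constant $u=(u_-,u_+)\in\mathbb{C}^2$, system (S) is the following system of ODEs for $E(t)=(E_-(t),E_+(t))\in\mathbb{C}^2$ and $N(t),n(t)\in\mathbb{R}$: $$\frac{d}{dt}E=-\kappa\big((1+i\alpha)X(N,n)E-u\big),\qquad \frac{d}{dt}\begin{bmatrix}N\\ n\end{bmatrix}=-\gamma\Big(Y(E)\begin{bmatrix}N\\ n\end{bmatrix}-\begin{bmatrix}\mu\\0\end{bmatrix}\Big).\tag{S}$$ An equilibrium point of (S) is a triple $(E,N,n)\in\mathbb{C}^2\times\mathbb{R}\times\mathbb{R}$ at which both right-hand sides vanish. The function $y:\mathbb{R}^2\to\mathbb{R}^2$ is $y(x):=Y(x)^{-1}(\mu,0)^T$. Fix $\widehat u=(\widehat u_-,\widehat u_+)\in\mathbb{C}^2\setminus\{0\}$ with $|\widehat u_-|=|\widehat u_+|$ (linear polarization). Let $\ell>0$ and let $E^{(j)}_{\widehat u}:\{\lambda\in\mathbb{C}:0<|\lambda|<\ell\}\to\mathbb{C}^2$, $j\in\mathcal J=\{0,\pm\mathrm L,\pm\mathrm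 R,\pm\mathrm X,\pm\mathrm Y\}$, be nine continuous functions with pairwise distinct values having the following properties (the paper establishes separately that such $\ell$ and functions exist): (P1) If $u=\lambda\widehat u$ with $0<|\lambda|<\ell$, then $(E,N,n)$ is an equilibrium point of (S) if and only if $E=E^{(j)}_{\widehat u}(\lambda)$ for some $j\in\mathcal J$ and $(N,n)=y(|E_-|,|E_+|)$. (P2) With $\theta:=-\arg(1+i\alpha)$, as $\lambda\to0$, $$E^{(0)}_{\widehat u}(\lambda)=e^{i\theta}\tfrac{\lambda}{|\lambda|}\big(|\lambda|\widehat w^{(0)}+o(\lambda)\big),$$ $$E^{(\pm\mathrm L)}_{\widehat u}(\lambda)=e^{i\theta}\tfrac{\lambda}{|\lambda|}\Big(\pm\sqrt{\tfrac{\delta(\mu-1)}{1+\delta}}\begin{bmatrix}\widehat u_-/|\widehat u_-|\\0\end{bmatrix}+|\lambda|\widehat w^{(\mathrm L)}+o(\lambda)\Big),\quad E^{(\pm\mathrm R)}_{\widehat u}(\lambda)=e^{i\theta}\tfrac{\lambda}{|\lambda|}\Big(\pm\sqrt{\tfrac{\delta(\mu-1)}{1+\delta}}\begin{bmatrix}0\\ \widehat u_+/|\widehat u_+|\end{bmatrix}+|\lambda|\widehat w^{(\mathrm R)}+o(\lambda)\Big),$$ $$E^{(\pm\mathrm X)}_{\widehat u}(\lambda)=e^{i\theta}\tfrac{\lambda}{|\lambda|}\Big(\pm\sqrt{\tfrac{\mu-1}{2}}\begin{bmatrix}\widehat u_-/|\widehat u_-|\\ \widehat u_+/|\widehat u_+|\end{bmatrix}+|\lambda|\widehat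 w^{(\mathrm X)}+o(\lambda)\Big),\quad E^{(\pm\mathrm Y)}_{\widehat u}(\lambda)=e^{i\theta}\tfrac{\lambda}{|\lambda|}\Big(\pm\sqrt{\tfrac{\mu-1}{2}}\begin{bmatrix}\widehat u_-/|\widehat u_-|\\ -\widehat u_+/|\widehat u_+|\end{bmatrix}+|\lambda|\widehat w^{(\mathrm Y)}+o(\lambda)\Big),$$ where, with $c:=1/(|1+i\alpha|(\mu-1))$, $$\widehat w^{(0)}=-c\,\widehat u,\quad \widehat w^{(\mathrm L)}=\tfrac{c}{2}\begin{bmatrix}\mu\widehat u_-\\ -(1+\delta)\widehat u_+\end{bmatrix},\quad \widehat w^{(\mathrm R)}=\tfrac{c}{2}\begin{bmatrix}-(1+\delta)\widehat u_-\\ \mu\widehat u_+\end{bmatrix},$$ $$\widehat w^{(\mathrm X)}=\tfrac{c}{4}\begin{bmatrix}(2\mu+\delta-1+(1-\delta)|\widehat u_+|/|\widehat u_-|)\widehat u_-\\ ((1-\delta)|\widehat u_-|/|\widehat u_+|+2\mu+\delta-1)\widehat u_+\end{bmatrix},\quad \widehat w^{(\mathrm Y)}=\tfrac{c}{4}\begin{bmatrix}(2\mu+\delta-1+(\delta-1)|\widehat u_+|/|\widehat u_-|)\widehat u_-\\ ((\delta-1)|\widehat u_-|/|\widehat u_+|+2\mu+\delta-1)\widehat u_+\end{bmatrix}.$$ (P3) For $j\in\{0,\pm\mathrm X\}$ and $0<|\lambda|<\ell$, $E^{(j)}_{\widehat u}(\lambda)=\rho^{(j)}(\lambda)\widehat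 u$ for some $\rho^{(j)}(\lambda)\in\mathbb{C}$. The activation function is $\rho:=\rho^{(+\mathrm X)}$, i.e. $E^{(+\mathrm X)}_{\widehat u}(\lambda)=\rho(\lambda)\widehat u$ for $0<|\lambda|<\ell$. The space $\mathbb{C}^{k_0}$ carries the Euclidean norm. *)

(* Defs.v *)
(* C is [R[i]] and C^n is ['cV[R[i]]_n], for [R : realType]. *)
From HB Require Import structures.
From mathcomp Require Import all_boot all_order all_algebra.
From mathcomp Require Import all_classical all_reals all_analysis.
From mathcomp.real_closed Require Export complex.

Set Implicit Arguments.
Unset Strict Implicit.
Unset Printing Implicit Defensive.

Import Order.TTheory GRing.Theory Num.Theory.
Import numFieldNormedType.Exports.
Export Normc.

Local Open Scope classical_set_scope.
Local Open Scope ring_scope.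
Local Open Scope complex_scope.

(* The topology of the modulus on C; matrices over C then inherit the product
   topology from the library. *)
HB.instance Definition _ (R : rcfType) := PseudoPointedMetric.copy R[i] R[i]^o.
HB.instance Definition _ (R : rcfType) := GRing.ComAlgebra.copy R[i] R[i]^o.
HB.instance Definition _ (R : rcfType) := Vector.copy R[i] R[i]^o.
HB.instance Definition _ (R : rcfType) := NormedModule.copy R[i] R[i]^o.

(* The norm [`|z|] of the library on ['cV[R[i]]_n] is the sup norm, hence this
   definition; [normc : R[i] -> R] is the modulus as a real number. *)
Definition enorm (R : realType) (n : nat) (z : 'cV[R[i]]_n) : R :=
  Num.sqrt (\sum_(i < n) normc (z i 0) ^+ 2).

Definition cball (R : realType) (n : nat) (r : R) : set 'cV[R[i]]_n :=
  [set z | enorm z <= r].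

Definition pdisc (R : realType) (r : R) : set R[i] :=
  [set z | 0 < normc z < r].

Section lebesgue_Rn.
Variable R : realType.
Local Notation Rn n := (n.-tuple (measurableTypeR R)).

Definition tcons (n : nat) (p : measurableTypeR R * Rn n) : Rn n.+1 :=
  [tuple of p.1 :: p.2].

Lemma measurable_tcons (n : nat) :
  measurable_fun [set: measurableTypeR R * Rn n] (@tcons n).
Proof. exact: measurable_cons. Qed.

HB.instance Definition _ n :=
  isMeasurableFun.Build _ _ _ _ (@tcons n) (@measurable_tcons n).

Section step.
Variables (n : nat) (mu : {sigma_finite_measure set (Rn n) -> \bar R}).

Definition lebesgue_step : set (Rn n.+1) -> \bar R :=
  pushforward (lebesgue_measure \x mu)%E (@tcons n).

Let lebesgue_step0 : lebesgue_step set0 = 0%E.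
Proof. exact: measure0. Qed.

Let lebesgue_step_ge0 A : (0 <= lebesgue_step A)%E.
Proof. exact: measure_ge0. Qed.

Let lebesgue_step_sigma_additive : semi_sigma_additive lebesgue_step.
Proof. exact: measure_semi_sigma_additive. Qed.

HB.instance Definition _ := isMeasure.Build _ _ _ lebesgue_step
  lebesgue_step0 lebesgue_step_ge0 lebesgue_step_sigma_additive.

Let lebesgue_step_sigma_finite : sigma_finite setT lebesgue_step.
Proof.
have /sigma_finiteP[F [TF ndF Foo]] := sigma_finiteT (@lebesgue_measure R).
have /sigma_finiteP[G [TG ndG Goo]] := sigma_finiteT mu.
pose uncons (t : Rn n.+1) := (thead t, [tuple of behead t] : Rn n).
have unconsE k : uncons @^-1` (F k `*` G k) =
    (fun t : Rn n.+1 => tnth t ord0) @^-1` F k `&`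
    (fun t : Rn n.+1 => [tuple of behead t] : Rn n) @^-1` G k by [].
exists (fun k => uncons @^-1` (F k `*` G k)).
  apply/esym; rewrite -subTset => t _.
  have [i _ Fi] : (\bigcup_k F k) (thead t) by rewrite -TF.
  have [j _ Gj] : (\bigcup_k G k) [tuple of behead t] by rewrite -TG.
  exists (maxn i j) => //; split.
    by move: Fi; exact/subsetPset/ndF/leq_maxl.
  by move: Gj; exact/subsetPset/ndG/leq_maxr.
move=> k; have [mF Fk] := Foo k; have [mG Gk] := Goo k; split.
  rewrite unconsE; apply: measurableI; rewrite -[X in measurable X]setTI.
    exact: (measurable_tnth ord0).
  exact: measurable_behead.
rewrite /lebesgue_step /pushforward -comp_preimage.
rewrite (_ : _ \o _ = idfun); last first.
  by apply/funext => -[x t]; congr pair; exact/val_inj.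
by rewrite preimage_id product_measure1E// lte_mul_pinfty// ge0_fin_numE.
Qed.

HB.instance Definition _ :=
  Measure_isSigmaFinite.Build _ _ _ lebesgue_step lebesgue_step_sigma_finite.

End step.

(* n-dimensional Lebesgue measure, the n-fold product of [lebesgue_measure]. *)
Fixpoint lebesgue_Rn (n : nat) : {sigma_finite_measure set (Rn n) -> \bar R} :=
  match n with
  | 0 => \d_([tuple] : Rn 0)
  | m.+1 => lebesgue_step (lebesgue_Rn m)
  end.

End lebesgue_Rn.

(* The identification C^n = R^(n + n): real parts first, then imaginary parts. *)
Definition C_of_R (R : realType) (n : nat)
    (x : (n + n).-tuple (measurableTypeR R)) : 'cV[R[i]]_n :=
  \col_(i < n) (tnth x (lshift n i) +i* tnth x (rshift n i)).

Definition R_of_C (R : realType) (n : nat) (z : 'cV[R[i]]_n) :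
    (n + n).-tuple (measurableTypeR R) :=
  [tuple match fintype.split k with
         | inl i => complex.Re (z i 0)
         | inr i => complex.Im (z i 0)
         end | k < n + n].

Section lebesgue_Cn.
Variables (R : realType) (n : nat).

Lemma R_of_CK : cancel (@R_of_C R n) (@C_of_R R n).
Proof.
move=> z; apply/colP => i; rewrite !mxE !tnth_mktuple.
rewrite (unsplitK (inl i)) (unsplitK (inr i)).
by case: (z i 0).
Qed.

Lemma C_of_RK : cancel (@C_of_R R n) (@R_of_C R n).
Proof.
move=> x; apply: eq_from_tnth => k; rewrite tnth_mktuple.
by case: split_ordP => i ->; rewrite mxE.
Qed.

Let measurableC : set (set 'cV[R[i]]_n) :=
  preimage_set_system setT (@R_of_C R n) measurable.

Let measurableC_sigma : sigma_algebra setT measurableC.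
Proof.
apply: sigma_algebra_preimage; exact: sigma_algebra_measurable.
Qed.

Let measurableC0 : measurableC set0.
Proof. by case: measurableC_sigma. Qed.

Let measurableCC A : measurableC A -> measurableC (~` A).
Proof. by case: measurableC_sigma => _ + _; rewrite -setTD; exact. Qed.

Let measurableCU (F : (set 'cV[R[i]]_n)^nat) :
  (forall i, measurableC (F i)) -> measurableC (\bigcup_i F i).
Proof. by case: measurableC_sigma => _ _; exact. Qed.

(* The Borel sigma-algebra of R^(n + n), transported to C^n. *)
HB.instance Definition _ := @isMeasurable.Build default_measure_display
  'cV[R[i]]_n measurableC measurableC0 measurableCC measurableCU.

Lemma measurable_C_of_R : measurable_fun setT (@C_of_R R n).
Proof.
move=> _ A [B mB <-]; rewrite !setTI -comp_preimage.
by rewrite (_ : _ \o _ = idfun) ?preimage_id//; apply/funext/C_of_RK.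
Qed.

HB.instance Definition _ :=
  isMeasurableFun.Build _ _ _ _ (@C_of_R R n) measurable_C_of_R.

Definition lebesgue_Cn : set 'cV[R[i]]_n -> \bar R :=
  pushforward (lebesgue_Rn R (n + n)) (@C_of_R R n).

Let lebesgue_Cn0 : lebesgue_Cn set0 = 0%E.
Proof. exact: measure0. Qed.

Let lebesgue_Cn_ge0 A : (0 <= lebesgue_Cn A)%E.
Proof. exact: measure_ge0. Qed.

Let lebesgue_Cn_sigma_additive : semi_sigma_additive lebesgue_Cn.
Proof. exact: measure_semi_sigma_additive. Qed.

HB.instance Definition _ := isMeasure.Build _ _ _ lebesgue_Cn
  lebesgue_Cn0 lebesgue_Cn_ge0 lebesgue_Cn_sigma_additive.

End lebesgue_Cn.

(* The norm of L^oo(A; C^k), as the library's essential-supremum norm of the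
   extension by zero of the pointwise Euclidean norm. *)
Definition Linfty_norm (R : realType) (n k : nat) (A : set 'cV[R[i]]_n)
    (g : 'cV[R[i]]_n -> 'cV[R[i]]_k) : \bar R :=
  Lnorm (@lebesgue_Cn R n) +oo%E ((fun z => (enorm (g z))%:E) \_ A).

Definition col2 (T : Type) (a b : T) : 'cV[T]_2 :=
  \col_(i < 2) (if i == 0 then a else b).

Definition mx22 (T : Type) (a b c d : T) : 'M[T]_2 :=
  \matrix_(i < 2, j < 2)
    (if i == 0 then (if j == 0 then a else b) else (if j == 0 then c else d)).

Section laser.
Variable R : realType.
Local Notation C := R[i].

Definition Xmx (z : 'cV[C]_2) : 'M[C]_2 :=
  mx22 (1 - (z 0 0 - z 1 0)) 0
       0 (1 - (z 0 0 + z 1 0)).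

Definition Ymx (delta : R) (z : 'cV[C]_2) : 'M[R]_2 :=
  mx22 (1 + enorm z ^+ 2) (normc (z 1 0) ^+ 2 - normc (z 0 0) ^+ 2)
       (normc (z 1 0) ^+ 2 - normc (z 0 0) ^+ 2) (delta + enorm z ^+ 2).

Definition yfun (mu delta : R) (x : 'cV[R]_2) : 'cV[R]_2 :=
  invmx (Ymx delta (map_mx (real_complex R) x)) *m col2 mu 0.

Definition rhsE (kappa alpha : R) (u E : 'cV[C]_2) (N n : R) : 'cV[C]_2 :=
  - (kappa%:C *: ((1 +i* alpha) *: (Xmx (col2 N%:C n%:C) *m E) - u)).

Definition rhsN (gamma mu delta : R) (E : 'cV[C]_2) (N n : R) : 'cV[R]_2 :=
  - (gamma *: (Ymx delta E *m col2 N n - col2 mu 0)).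

Definition equilibrium (kappa gamma delta alpha mu : R) (u E : 'cV[C]_2)
    (N n : R) : Prop :=
  rhsE kappa alpha u E N n = 0 /\ rhsN gamma mu delta E N n = 0.

(* Principal argument, in ]-pi, pi]; [carg 0] is irrelevant. *)
Definition carg (z : C) : R :=
  if 0 <= complex.Im z then acos (complex.Re z / normc z)
  else - acos (complex.Re z / normc z).

Definition expi (t : R) : C := cos t +i* sin t.

(* Phase factor, [z / |z|]. *)
Definition phase (z : C) : C := z / (normc z)%:C.

Inductive mode : Type :=
  J0 | JLp | JLm | JRp | JRm | JXp | JXm | JYp | JYm.

(* Leading coefficients of the nine expansions as lambda tends to 0. *)
Definition lead (mu delta : R) (u : 'cV[C]_2) (j : mode) : 'cV[C]_2 :=
  let s := (Num.sqrt (delta * (mu - 1) / (1 + delta)))%:C in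
  let t := (Num.sqrt ((mu - 1) / 2))%:C in
  match j with
  | J0 => 0
  | JLp => s *: col2 (phase (u 0 0)) 0
  | JLm => - (s *: col2 (phase (u 0 0)) 0)
  | JRp => s *: col2 0 (phase (u 1 0))
  | JRm => - (s *: col2 0 (phase (u 1 0)))
  | JXp => t *: col2 (phase (u 0 0)) (phase (u 1 0))
  | JXm => - (t *: col2 (phase (u 0 0)) (phase (u 1 0)))
  | JYp => t *: col2 (phase (u 0 0)) (- phase (u 1 0))
  | JYm => - (t *: col2 (phase (u 0 0)) (- phase (u 1 0)))
  end.

(* Coefficients of |lambda| in these expansions. *)
Definition what (mu delta alpha : R) (u : 'cV[C]_2) (j : mode) : 'cV[C]_2 :=
  let c := 1 / (normc (1 +i* alpha) * (mu - 1)) in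
  let um := normc (u 0 0) in
  let up := normc (u 1 0) in
  match j with
  | J0 => - (c%:C *: u)
  | JLp | JLm =>
      (c / 2)%:C *: col2 (mu%:C * u 0 0) (- (1 + delta)%:C * u 1 0)
  | JRp | JRm =>
      (c / 2)%:C *: col2 (- (1 + delta)%:C * u 0 0) (mu%:C * u 1 0)
  | JXp | JXm =>
      (c / 4)%:C *: col2
        ((2 * mu + delta - 1 + (1 - delta) * up / um)%:C * u 0 0)
        (((1 - delta) * um / up + 2 * mu + delta - 1)%:C * u 1 0)
  | JYp | JYm =>
      (c / 4)%:C *: col2
        ((2 * mu + delta - 1 + (delta - 1) * up / um)%:C * u 0 0)
        (((delta - 1) * um / up + 2 * mu + delta - 1)%:C * u 1 0)
  end.

End laser.

Section network.
Variables (R : realType) (i0 j0 k0 : nat).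

Definition preact (a : 'M[R[i]]_(j0, i0)) (b : 'cV[R[i]]_j0)
    (z : 'cV[R[i]]_i0) (j : 'I_j0) : R[i] :=
  \sum_(i < i0) a j i * z i 0 + b j 0.

Definition network (rho : R[i] -> R[i]) (a : 'M[R[i]]_(j0, i0))
    (b : 'cV[R[i]]_j0) (c : 'M[R[i]]_(k0, j0)) (z : 'cV[R[i]]_i0) :
    'cV[R[i]]_k0 :=
  \col_(k < k0) \sum_(j < j0) c k j * rho (preact a b z j).

End network.

(* Main.v *)
Require Import Defs.
From HB Require Import structures.
From mathcomp Require Import all_boot all_order all_algebra.
From mathcomp Require Import all_classical all_reals all_analysis.
From mathcomp Require Import measurable_realfun ess_sup_inf.
From mathcomp.real_closed Require Import complex.
From mathcomp Require Import ring lra.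

Import Order.TTheory GRing.Theory Num.Theory.
Import numFieldNormedType.Exports.

Set Implicit Arguments.
Unset Strict Implicit.
Unset Printing Implicit Defensive.

Local Open Scope classical_set_scope.
Local Open Scope ring_scope.
Local Open Scope complex_scope.

(** Only the behaviour of the activation function rho at the origin matters.  Write
    phase x = x / |x|.  By the expansion of the branch +X, there is a constant k with
    k rho x - phase x -> 0 as x -> 0 ([activation_phase]).  As phase is invariant under
    positive scaling, k rho (t y) tends to phase y as t -> 0+, uniformly for y in any
    bounded set that avoids 0.  So every function phase (1 + a z), where the linear form
    a satisfies |a z| <= 1/2 on the ball, is a uniform limit of one-neuron networks
    ([shallow_limit_phase]), and it remains to see that these functions span a dense
    subspace of the continuous functions on the ball.  The inputs of the neurons used
    never vanish on the ball, so the inequalities hold, and the approximation is uniform,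
    at every point and not only almost everywhere.

    Let V be the uniform closure of the span.  The function
      phase (1 + x) = (1 + x)^(1/2) (1 + conj x)^(-1/2)
    has an expansion in x and conj x in which no coefficient vanishes ([phase_taylor],
    [phase_coef_neq0]): it is neither holomorphic nor annihilated by a power of the
    Laplacian.  Substituting x = t s (a z), with t > 0 tending to 0 and s varying in the
    complex plane, puts every monomial (a z)^m (conj (a z))^l in V ([cs_monomials]), in
    particular every power of every real linear form z |-> Re (a z).

    By polarization V then contains the products of these forms.  This is organised
    through a multiplier algebra.  The bounded functions h such that every product
    h(z) (Re (a z))^N is in V, for all a and N, form a subspace of V; the functions that
    multiply this subspace into itself form a uniformly closed algebra, contained in V,
    that contains the real linear forms ([ridge_multiplier_algebra],
    [ridge_multiplier_form], [ridge_multiplier_sub]).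
    These separate the points of the ball, which is compact ([cball_compact]), and
    [stone_weierstrass] concludes for real functions, hence for complex ones
    ([shallow_universal]); vector-valued functions are treated componentwise
    ([network_of_shallow]).

    The network is measurable because rho is continuous on the punctured disc
    ([network_measurable]). *)

(** * Truncated Taylor series of the inverse square root *)

Section inverse_square_root.
Variable K : numFieldType.

(** The Taylor coefficients of (1 + x)^(-1/2), that is, the binomial coefficients
    of exponent -1/2; the recursion avoids dividing by a factorial. *)
Fixpoint binv (k : nat) : K :=
  if k is k'.+1 then - binv k' * (2 * k'%:R + 1) / (2 * k'.+1%:R) else 1.

Lemma binvS k : 2 * k.+1%:R * binv k.+1 = - (2 * k%:R + 1) * binv k.
Proof.
have k0 : (k.+1%:R : K) != 0 by rewrite pnatr_eq0.
by rewrite /=; field; rewrite nat1r.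
Qed.

Lemma binv_neq0 k : binv k != 0.
Proof.
elim: k => [|k IH] /=; first exact: oner_neq0.
by rewrite !mulf_neq0 ?oppr_eq0 ?invr_eq0 ?mulf_neq0 ?pnatr_eq0// -natrM natr1 pnatr_eq0.
Qed.

(** The Taylor coefficients of (1 + x)^(1/2) = (1 + x) (1 + x)^(-1/2). *)
Definition bsqrt (k : nat) : K := if k is k'.+1 then binv k'.+1 + binv k' else 1.

Lemma bsqrt_neq0 k : bsqrt k != 0.
Proof.
case: k => [|k]; first exact: oner_neq0.
have k0 : (2 * k.+1%:R : K) != 0 by rewrite mulf_neq0 // pnatr_eq0.
rewrite -(inj_eq (mulfI k0)) mulr0 /bsqrt mulrDr binvS -mulrDl.
rewrite mulf_neq0 ?binv_neq0 // -[k.+1%:R]natr1.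
by rewrite (_ : - _ + _ = 1) ?oner_neq0 //; ring.
Qed.

(** The series y of (1 + x)^(-1/2) solves 2 (1 + x) y' + y = 0; for its truncation A
    only a term in X^N survives on the right.  The derivative of A^2 (1 + X) is
    A (2 (1 + X) A' + A), hence divisible by X^N.  Truncating keeps the argument
    algebraic: no convergence is involved. *)
Lemma trunc_invsqrtK N : exists Q : {poly K},
  (\poly_(i < N.+1) binv i) ^+ 2 * (1 + 'X) = 1 + 'X^(N.+1) * Q.
Proof.
set A := \poly_(i < N.+1) binv i; set B := _ * _.
have dA : 2%:P * (1 + 'X) * A^`() + A = ((2 * N%:R + 1) * binv N) *: 'X^N.
  apply/polyP => i; rewrite coefD -mulrA coefCM [(1 + 'X) * _]mulrDl.
  rewrite [1 * _]mul1r coefD coefXM coefZ coefXn !coef_deriv !coef_poly ltnS.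
  have -> : (if i == 0%N then 0 else
      ((if (i.-1.+1 < N.+1)%N then binv i.-1.+1 else 0) *+ i.-1.+1)) =
      i%:R * (if (i < N.+1)%N then binv i else 0).
    by case: i => [|i] /=; [rewrite mul0r | exact/esym/mulr_natl].
  rewrite -[_ *+ i.+1]mulr_natl.
  case: (ltngtP i N) => [iN|iN|->].
  - rewrite !ltnS (ltnW iN) mulr0.
    transitivity (2 * i.+1%:R * binv i.+1 + 2 * i%:R * binv i + binv i).
      by ring.
    by rewrite binvS; ring.
  - by rewrite !ltnS leqNgt iN /= !mulr0 !addr0 mulr0.
  - by rewrite ltnSn mulr1 mulr0; ring.
have dB : B^`() = ((2 * N%:R + 1) * binv N) *: ('X^N * A).
  rewrite scalerAl -dA /B expr2 !derivM derivD derivX -polyC1 derivC polyC1.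
  by ring.
exists (drop_poly N.+1 B).
rewrite -[LHS](poly_take_drop N.+1) [X in _ + X]mulrC; congr (_ + _).
apply/polyP => -[|i]; rewrite coef_take_poly coef1 /=.
  by rewrite /B -horner_coef0 !hornerE horner_poly big_ord_recl big1 => [|i _];
    rewrite ?addr0 ?expr1n ?mulr1 ?expr1n // expr0n mulr0.
case: ifP => // iN; apply/eqP.
have : B`_i.+1 *+ i.+1 == 0 by rewrite -coef_deriv dB coefZ coefXnM -ltnS iN mulr0.
by rewrite mulrn_eq0.
Qed.
End inverse_square_root.

(** * The modulus of complex numbers *)

Section modulus.
Variable R : realType.
Implicit Types x y : R[i].

Lemma normc_ge0 x : 0 <= normc x.
Proof. by case: x => a b; exact: sqrtr_ge0. Qed.

Lemma normcX x n : normc (x ^+ n) = normc x ^+ n.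
Proof. by elim: n => [|n IH]; rewrite ?expr0 ?normc1 // !exprS normcM IH. Qed.

Lemma normc_conj x : normc x^*%C = normc x.
Proof. by case: x => a b; rewrite /= sqrrN. Qed.

Lemma normc_real (a : R) : normc a%:C = `|a|.
Proof. by rewrite /normc /= expr0n addr0 sqrtr_sqr. Qed.

Lemma normcB_sym x y : normc (x - y) = normc (y - x).
Proof. by rewrite -normcN opprB. Qed.

Lemma normc_sum I (r : seq I) (P : pred I) (F : I -> R[i]) :
  normc (\sum_(j <- r | P j) F j) <= \sum_(j <- r | P j) normc (F j).
Proof.
elim/big_ind2 : _ => [|x a y b xa yb|//]; first by rewrite normc0.
exact: le_trans (le_normcD _ _) (lerD xa yb).
Qed.

Lemma normc_conjM x : x * x^*%C = (normc x ^+ 2)%:C.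
Proof. by rewrite -sqr_normc normc_def rmorphXn; case: x. Qed.

Lemma normc_distl x y : `|normc x - normc y| <= normc (x - y).
Proof.
have H (a b : R[i]) : normc a <= normc (a - b) + normc b.
  by rewrite -{1}[a](subrK b) le_normcD.
have := H x y; have := H y x; rewrite (normcB_sym y) ler_norml; lra.
Qed.

Lemma normc_neq0 x : (normc x != 0) = (x != 0).
Proof.
by congr (~~ _); apply/eqP/eqP => [/eq0_normc|->]; rewrite ?normc0.
Qed.

Lemma normc_gt0 x : (0 < normc x) = (x != 0).
Proof. by rewrite lt_def normc_ge0 andbT normc_neq0. Qed.

Lemma normc_phase x : x != 0 -> normc (phase x) = 1.
Proof.
move=> x0; rewrite /phase normcM normcV normc_real ger0_norm ?normc_ge0 //.
by rewrite divff // normc_neq0.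
Qed.

End modulus.

(** * The expansion of the phase at 1 *)

Section phase_expansion.
Variable R : realType.
Notation C := R[i].

Lemma conj_binv k : (binv C k)^*%C = binv C k.
Proof.
elim: k => [|k IH] /=; first exact: conjc1.
rewrite !(rmorphM, rmorphN, fmorphV, rmorphD, rmorph_nat, rmorph1).
by rewrite -[in RHS]IH.
Qed.

Lemma poly_bounded (q : {poly C}) :
  exists2 M, 0 <= M & forall x, normc x <= 1 -> normc q.[x] <= M.
Proof.
exists (\sum_(i < size q) normc q`_i); first by apply: sumr_ge0 => i _; exact: normc_ge0.
move=> x x1; rewrite horner_coef; apply: le_trans (normc_sum _ _ _) _.
apply: ler_sum => i _; rewrite normcM normcX.
by rewrite ler_piMr ?normc_ge0// exprn_ile1 ?normc_ge0.
Qed.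

(** The coefficient of x^m (conj x)^l in
    phase (1 + x) = (1 + x)^(1/2) (1 + conj x)^(-1/2). *)
Definition phase_coef m l : C := bsqrt C m * binv C l.

Lemma phase_coef_neq0 m l : phase_coef m l != 0.
Proof. by rewrite mulf_neq0 ?bsqrt_neq0 ?binv_neq0. Qed.

(** Let A be the truncated series of (1 + x)^(-1/2).  Then (1 + x) A(x) A(conj x) is
    phase (1 + x) times the nonnegative real |1 + x| |A(x)|^2 = |(1 + x) A(x)^2|,
    which is |1 + x^(N+1) Q(x)| for a polynomial Q by [trunc_invsqrtK], so within
    O(|x|^(N+1)) of 1.  The top term of (1 + x) A(x) is also O(|x|^(N+1)) and is
    dropped, since its coefficient is that of the truncation and not of the series. *)
Lemma phase_taylor N : exists M, forall x : C, normc x <= 1 / 2 ->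
  normc (phase (1 + x) - \sum_(m < N.+1) \sum_(l < N.+1)
     phase_coef m l * x ^+ m * x^*%C ^+ l) <= M * normc x ^+ N.+1.
Proof.
have [Q QE] := @trunc_invsqrtK C N.
set P := \poly_(i < N.+1) binv C i in QE.
have [MQ MQ0 bQ] := poly_bounded Q.
have [MP MP0 bP] := poly_bounded P.
exists (MQ + normc (binv C N) * MP) => x x2.
have x1 : normc x <= 1 by lra.
have y0 : 1 + x != 0.
  apply: contraTneq x2 => /eqP; rewrite addrC addr_eq0 => /eqP ->.
  by rewrite normcN normc1; lra.
have Pconj : P.[x^*%C] = (P.[x])^*%C.
  rewrite !horner_poly rmorph_sum; apply: eq_bigr => i _.
  by rewrite rmorphM rmorphXn /= conj_binv.
have PE : (1 + x) * P.[x] = \sum_(m < N.+1) bsqrt C m * x ^+ m + binv C N * x ^+ N.+1.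
  rewrite mulrDl mul1r {1}horner_poly big_ord_recl [in RHS]big_ord_recl.
  rewrite horner_poly big_ord_recr /= mulrDr mulr_sumr -!addrA; congr (_ + _).
  rewrite addrA -big_split /=; congr (_ + _); last by rewrite exprS; ring.
  by apply: eq_bigr => i _; rewrite /bump /= add1n /bsqrt exprS; ring.
have -> : \sum_(m < N.+1) \sum_(l < N.+1) phase_coef m l * x ^+ m * x^*%C ^+ l =
    (1 + x) * P.[x] * P.[x^*%C] - binv C N * x ^+ N.+1 * P.[x^*%C].
  rewrite PE mulrDl addrK horner_poly mulr_suml; apply: eq_bigr => m _.
  by rewrite mulr_sumr; apply: eq_bigr => l _; rewrite /phase_coef; ring.
rewrite opprB addrCA.
apply: le_trans (le_normcD _ _) _; rewrite [leRHS]mulrDl [leRHS]addrC; apply: lerD.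
  rewrite !normcM normcX mulrAC; apply: ler_wpM2r; first by rewrite exprn_ge0 ?normc_ge0.
  by apply: ler_wpM2l; rewrite ?normc_ge0// bP// normc_conj.
have -> : (1 + x) * P.[x] * P.[x^*%C] =
    phase (1 + x) * (normc (1 + x ^+ N.+1 * Q.[x]))%:C.
  have -> : 1 + x ^+ N.+1 * Q.[x] = P.[x] ^+ 2 * (1 + x).
    have := congr1 (fun q => q.[x]) QE.
    by rewrite !hornerE => ->.
  rewrite -mulrA Pconj normc_conjM normcM normcX rmorphM /= /phase.
  rewrite -mulrA mulrC -[LHS]mulr1; field.
  by rewrite fmorph_eq0 normc_neq0.
rewrite -{1}[phase (1 + x)]mulr1 -mulrBr normcM normc_phase // mul1r.
rewrite -[X in normc (X - _)](rmorph1 (real_complex R)) -rmorphB normc_real.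
rewrite -[X in `|X - _|]normc1.
apply: le_trans (normc_distl _ _) _.
rewrite opprD addrA subrr sub0r normcN normcM normcX mulrC.
by apply: ler_wpM2r; rewrite ?exprn_ge0 ?normc_ge0 ?bQ.
Qed.
End phase_expansion.

(** * Uniformly closed spaces of functions *)

Section closed_subspaces.
Variables (R : realType) (T : Type) (B : set T).
Notation C := R[i].

Definition uniform_adherent (V : set (T -> C)) (g : T -> C) :=
  forall e, 0 < e -> exists2 h, V h & forall z, B z -> normc (h z - g z) <= e.

Record closed_subspace (V : set (T -> C)) : Prop := ClosedSubspace {
  cs_zero : V (fun=> 0);
  cs_lin : forall c g h, V g -> V h -> V (fun z => c * g z + h z);
  cs_lim : forall g, uniform_adherent V g -> V g }.

Variables (V : set (T -> C)) (csV : closed_subspace V).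

Lemma cs_ext g h : V g -> (forall z, B z -> g z = h z) -> V h.
Proof.
move=> Vg gh; apply: (cs_lim csV) => e e0; exists g => // z Bz.
by rewrite gh // subrr normc0 ltW.
Qed.

Lemma cs_scale c g : V g -> V (fun z => c * g z).
Proof.
move=> Vg; apply: cs_ext (cs_lin csV c Vg (cs_zero csV)) _ => z _.
by rewrite addr0.
Qed.

Lemma cs_sum I (r : seq I) (P : pred I) (c : I -> C) (g : I -> T -> C) :
  (forall j, P j -> V (g j)) -> V (fun z => \sum_(j <- r | P j) c j * g j z).
Proof.
move=> Vg; elim: r => [|j r IH].
  by apply: cs_ext (cs_zero csV) _ => z _; rewrite big_nil.
case Pj: (P j); last by apply: cs_ext IH _ => z _; rewrite big_cons Pj.
by apply: cs_ext (cs_lin csV (c j) (Vg _ Pj) IH) _ => z _; rewrite big_cons Pj.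
Qed.

(** Divide by t^N and let t tend to 0. *)
Lemma cs_leading_coef N (F : R -> T -> C) (G : T -> C) (d M : R) : 0 < d ->
  (forall t, 0 < t <= d -> V (F t)) ->
  (forall t z, 0 < t <= d -> B z ->
     normc (F t z - (t ^+ N)%:C * G z) <= M * t ^+ N.+1) ->
  V G.
Proof.
move=> d0 VF FG; apply: (cs_lim csV) => e e0.
pose t := Num.min d (e / (`|M| + 1)).
have M1 : 0 < `|M| + 1 by rewrite ltr_wpDl.
have t0 : 0 < t by rewrite lt_min d0 divr_gt0.
have td : 0 < t <= d by rewrite t0 ge_min lexx.
have tN : t ^+ N != 0 by rewrite expf_neq0 // gt_eqF.
exists (fun z => (t ^- N)%:C * F t z); first exact/cs_scale/VF.
move=> z Bz.
have -> : (t ^- N)%:C * F t z - G z = (t ^- N)%:C * (F t z - (t ^+ N)%:C * G z).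
  by rewrite mulrBr mulrA -rmorphM /= mulVf // mul1r.
rewrite normcM normc_real ger0_norm; last by rewrite invr_ge0 exprn_ge0 ?ltW.
rewrite mulrC ler_pdivrMr ?exprn_gt0 //; apply: le_trans (FG _ _ td Bz) _.
rewrite exprS mulrA; apply: ler_wpM2r; first by rewrite exprn_ge0 ?ltW.
have : t <= e / (`|M| + 1) by rewrite ge_min lexx orbT.
rewrite ler_pdivlMr // => te; apply: le_trans te; rewrite mulrC.
by apply: ler_wpM2l; [exact: ltW | have := ler_norm M; lra].
Qed.

(** The columns of the inverse of the Vandermonde matrix of the nodes x_0, ...,
    x_(n-1) are the coefficients of the linear combinations that isolate each v m. *)
Lemma cs_vandermonde n (x : nat -> C) (v : nat -> T -> C) : injective x ->
  (forall j, V (fun z => \sum_(m < n) x j ^+ m * v m z)) ->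
  forall m, (m < n)%N -> V (v m).
Proof.
move=> xI Vx m mn; pose W := Vandermonde n (\row_(j < n) x j).
have uW : W \in unitmx.
  rewrite unitmxE det_Vandermonde unitfE prodf_seq_neq0; apply/allP => i _.
  rewrite prodf_seq_neq0; apply/allP => j _ /=; apply/implyP => ij.
  by rewrite !mxE subr_eq0 (inj_eq xI) gtn_eqF.
have /cs_sum : forall j : 'I_n, xpredT j ->
  V (fun z => \sum_(k < n) x j ^+ k * v k z) by [].
move=> /(_ (index_enum _) (fun j => invmx W j (Ordinal mn))) /cs_ext; apply => z _.
under eq_bigr do rewrite mulr_sumr.
rewrite exchange_big (bigD1 (Ordinal mn)) //= [X in _ + X]big1 ?addr0.
  transitivity ((W *m invmx W) (Ordinal mn) (Ordinal mn) * v m z).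
    by rewrite mxE mulr_suml; apply: eq_bigr => j _; rewrite !mxE; ring.
  by rewrite mulmxV // !mxE eqxx mul1r.
move=> k km; transitivity ((W *m invmx W) k (Ordinal mn) * v k z).
  by rewrite mxE mulr_suml; apply: eq_bigr => j _; rewrite !mxE; ring.
by rewrite mulmxV // !mxE (negPf km) mul0r.
Qed.

(** By induction on N = m + l.  For t > 0 small, phase (1 + t s w) minus the terms of
    degree less than N of its expansion is in V, so its leading coefficient in t, the
    part of degree N, is in V for every complex s.  In this part the monomial
    w^m (conj w)^l carries the factor s^m (conj s)^l = (conj s)^N (s / conj s)^m, so
    infinitely many values of s / conj s separate the monomials, and each has a
    nonzero coefficient. *)
Lemma cs_monomials (w : T -> C) (M : R) : 0 < M ->
  (forall z, B z -> normc (w z) <= M) ->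
  (forall s, normc s * M <= 1 / 2 -> V (fun z => phase (1 + s * w z))) ->
  forall m l, V (fun z => w z ^+ m * (w z)^*%C ^+ l).
Proof.
move=> M0 wM Vph.
pose a (p : nat * nat) x := phase_coef R p.1 p.2 * x ^+ p.1 * x^*%C ^+ p.2.
suff H N : forall m l, (m + l = N)%N -> V (fun z => w z ^+ m * (w z)^*%C ^+ l).
  by move=> m l; exact: H.
elim/ltn_ind: N => N IH.
have [K HK] := @phase_taylor R N.
have aM p x y : a p (x * y) = x ^+ p.1 * x^*%C ^+ p.2 * a p y.
  by rewrite /a rmorphM /= !exprMn; ring.
have hom s : V (fun z => \sum_(m < N.+1) \sum_(l < N.+1 | (m + l == N)%N)
    a (m : nat, l : nat) (s * w z)).
  (* The pairs of exponents of total degree less than, more than and equal to N. *)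
  pose S1 : pred ('I_N.+1 * 'I_N.+1) := fun p => (p.1 + p.2 < N)%N.
  pose S2 : pred ('I_N.+1 * 'I_N.+1) := fun p => (N < p.1 + p.2)%N.
  pose S3 : pred ('I_N.+1 * 'I_N.+1) := fun p => (p.1 + p.2 == N)%N.
  pose pr (p : 'I_N.+1 * 'I_N.+1) := (p.1 : nat, p.2 : nat).
  pose s1 := normc s + 1.
  have s10 : 0 < s1 by rewrite ltr_wpDl ?normc_ge0.
  have d0 : 0 < 1 / (2 * s1 * M) by rewrite divr_gt0 ?mulr_gt0.
  have tsw t z : 0 < t <= 1 / (2 * s1 * M) -> B z ->
      normc (t%:C * s * w z) <= t * (s1 * M) /\ t * (s1 * M) <= 1 / 2.
    move=> /andP[t0 td] Bz; split.
      rewrite !normcM normc_real gtr0_norm // -mulrA; apply: ler_wpM2l; first exact: ltW.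
      by apply: ler_pM; rewrite ?normc_ge0 ?wM // lerDl.
    move: td; rewrite ler_pdivlMr ?mulr_gt0 //; lra.
  apply: (@cs_leading_coef N (fun t z => phase (1 + t%:C * s * w z) -
     \sum_(p | S1 p) a (pr p) (t%:C * s * w z)) _ _
     ((`|K| + \sum_(p | S2 p) normc (phase_coef R p.1 p.2)) * (s1 * M) ^+ N.+1) d0).
    move=> t td.
    have Vp : V (fun z => \sum_(p | S1 p)
        ((t%:C * s) ^+ p.1 * (t%:C * s)^*%C ^+ p.2 * phase_coef R p.1 p.2) *
        (w z ^+ p.1 * (w z)^*%C ^+ p.2)).
      by apply: cs_sum => p Sp; apply: IH Sp _ _ erefl.
    have Vt : V (fun z => phase (1 + t%:C * s * w z)).
      apply: Vph; rewrite normcM normc_real.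
      case/andP: td => t0; rewrite gtr0_norm // ler_pdivlMr ?mulr_gt0 // => td.
      have := normc_ge0 s; rewrite /s1 in td *; have := mulr_gt0 t0 M0; nra.
    apply: cs_ext (cs_lin csV (-1) Vp Vt) _ => z _.
    rewrite mulN1r addrC; congr (_ - _); apply: eq_bigr => p _.
    by rewrite aM /a /=; ring.
  move=> t z td Bz; have [tsw1 tsw2] := tsw t z td Bz.
  set x := t%:C * s * w z in tsw1 *.
  have -> : (t ^+ N)%:C * (\sum_(m < N.+1) \sum_(l < N.+1 | (m + l == N)%N)
      a (m : nat, l : nat) (s * w z)) = \sum_(p | S3 p) a (pr p) x.
    rewrite (pair_big_dep xpredT (fun m l : 'I_N.+1 => m + l == N)%N) /= mulr_sumr.
    apply: eq_bigr => p /eqP pN.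
    rewrite /x -mulrA [in RHS]aM conjc_real -exprD -rmorphXn.
    by have -> : ((pr p).1 + (pr p).2 = N)%N by exact: pN.
  have split3 : \sum_(m < N.+1) \sum_(l < N.+1) phase_coef R m l * x ^+ m * x^*%C ^+ l =
      \sum_(p | S1 p) a (pr p) x + \sum_(p | S3 p) a (pr p) x +
      \sum_(p | S2 p) a (pr p) x.
    rewrite pair_big /= !(big_mkcond S1, big_mkcond S2, big_mkcond S3) /=.
    rewrite -!big_split; apply: eq_bigr => p _ /=; rewrite /S1 /S2 /S3 /a /=.
    by case: ltngtP => _; rewrite ?addr0 ?add0r.
  set y := phase _ in split3 *.
  have -> : y - \sum_(p | S1 p) a (pr p) x - \sum_(p | S3 p) a (pr p) x =
      (y - \sum_(m < N.+1) \sum_(l < N.+1) phase_coef R m l * x ^+ m * x^*%C ^+ l)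
      + \sum_(p | S2 p) a (pr p) x by rewrite split3; ring.
  have x2 : normc x <= 1 / 2 by exact: le_trans tsw1 tsw2.
  apply: le_trans (le_normcD _ _) _.
  have xN : normc x ^+ N.+1 <= (s1 * M) ^+ N.+1 * t ^+ N.+1.
    rewrite -exprMn mulrC; apply: lerXn2r => //; rewrite nnegrE ?normc_ge0 //.
    exact: le_trans (normc_ge0 _) tsw1.
  rewrite -mulrA [leRHS]mulrDl; apply: lerD.
    apply: le_trans (HK _ x2) _; apply: le_trans (ler_wpM2r _ (ler_norm K)) _.
      by rewrite exprn_ge0 ?normc_ge0.
    exact: ler_wpM2l.
  apply: le_trans (normc_sum _ _ _) _; rewrite mulr_suml; apply: ler_sum => p Sp.
  rewrite /a /= !normcM !normcX normc_conj -mulrA -exprD.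
  apply: ler_wpM2l; first by rewrite mulr_ge0 ?normc_ge0.
  apply: le_trans xN; apply: ler_wiXn2l; rewrite ?normc_ge0 //; lra.
move=> m l mlN.
have mN : (m < N.+1)%N by rewrite ltnS -mlN leq_addr.
(* The ratios s / conj s at s = 1 + i j, which are pairwise distinct. *)
pose x (j : nat) : C := (1 +i* j%:R) / (1 -i* j%:R).
have den0 j : (1 -i* j%:R : C) != 0.
  by apply/negP => /eqP [] /eqP; rewrite oner_eq0.
have num0 j : (1 +i* j%:R : C) != 0.
  by apply/negP => /eqP [] /eqP; rewrite oner_eq0.
have xI : injective x.
  move=> j k /eqP; rewrite eqr_div ?den0 // => /eqP [] _.
  rewrite !mul1r !mulr1 => jk; apply/eqP; rewrite -(@eqr_nat R); apply/eqP; lra.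
pose v (m : nat) z := \sum_(l < N.+1 | (m + l == N)%N) a (m, l : nat) (w z).
have Vx j : V (fun z => \sum_(m < N.+1) x j ^+ m * v m z).
  apply: cs_ext (cs_scale (((1 -i* j%:R) ^- N)) (hom (1 +i* j%:R))) _ => z _.
  rewrite mulr_sumr; apply: eq_bigr => m' _; rewrite !mulr_sumr.
  apply: eq_bigr => l' /eqP ml'; rewrite aM /= /x expr_div_n.
  have -> : (1 -i* j%:R : C) ^- N = (1 -i* j%:R) ^- m' * (1 -i* j%:R) ^- l'.
    by rewrite -invfM -exprD ml'.
  by field; rewrite ?expf_neq0 // den0.
have Vv := cs_vandermonde xI Vx mN.
have vE z : v m z = phase_coef R m l * (w z ^+ m * (w z)^*%C ^+ l).
  have lN : (l < N.+1)%N by rewrite ltnS -mlN leq_addl.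
  rewrite /v (big_pred1 (Ordinal lN)) => [|l' /=]; first by rewrite /a /= mulrA.
  by rewrite -(inj_eq val_inj) /= -[in RHS](eqn_add2l m) mlN.
apply: cs_ext (cs_scale (phase_coef R m l)^-1 Vv) _ => z _.
by rewrite vE mulrA mulVf ?mul1r // phase_coef_neq0.
Qed.

End closed_subspaces.

(** * From powers of real linear forms to an algebra *)

Section closed_algebras.
Variables (R : realType) (T : Type) (B : set T).

Definition bounded_on (g : T -> R) :=
  exists2 M, 0 <= M & forall z, B z -> `|g z| <= M.

Lemma bounded_on_cst c : bounded_on (fun=> c).
Proof. by exists `|c|. Qed.

Lemma bounded_on_lin c g h : bounded_on g -> bounded_on h ->
  bounded_on (fun z => c * g z + h z).
Proof.
move=> [M M0 gM] [M' M'0 hM']; exists (`|c| * M + M').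
  by rewrite addr_ge0 // mulr_ge0.
move=> z Bz; apply: le_trans (ler_normD _ _) _.
by rewrite normrM lerD ?hM' // ler_wpM2l ?gM.
Qed.

Lemma bounded_on_mul g h : bounded_on g -> bounded_on h ->
  bounded_on (fun z => g z * h z).
Proof.
move=> [M M0 gM] [M' M'0 hM']; exists (M * M'); first exact: mulr_ge0.
by move=> z Bz; rewrite normrM ler_pM ?gM ?hM'.
Qed.

Record closed_algebra (A : set (T -> R)) : Prop := ClosedAlgebra {
  ca_bounded : forall g, A g -> bounded_on g;
  ca_cst : forall c, A (fun=> c);
  ca_lin : forall c g h, A g -> A h -> A (fun z => c * g z + h z);
  ca_mul : forall g h, A g -> A h -> A (fun z => g z * h z);
  ca_lim : forall g,
    (forall e, 0 < e -> exists2 h, A h & forall z, B z -> `|h z - g z| <= e) ->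
    A g }.

Lemma bounded_on_lim g :
  (forall e, 0 < e -> exists2 h, bounded_on h & forall z, B z -> `|h z - g z| <= e) ->
  bounded_on g.
Proof.
move=> /(_ 1 ltr01) [h [M M0 hM] gh]; exists (M + 1); first by rewrite addr_ge0.
move=> z Bz; have := hM z Bz; have := gh z Bz.
by rewrite !ler_norml; lra.
Qed.

(** A subspace V that contains the powers of the forms [L d] need not contain their
    products a priori.  It does: the functions g such that all g (L d)^N are in V form
    a module over [L d], as the coefficient of t in g (L d' + t L d)^(N+1) shows.
    The multipliers of this module then form a closed algebra inside V. *)

Section ridge_functions.
Variables (V : set (T -> R[i])) (csV : closed_subspace B V).
Variables (D : lmodType R[i]) (L : D -> T -> R).
Hypothesis L_lin : forall d d' t z, L (d + t%:C *: d') z = L d z + t * L d' z.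
Hypothesis L_bounded : forall d, bounded_on (L d).
Hypothesis L_powers : forall d N, V (fun z => (L d z ^+ N)%:C).

Definition ridge_module (g : T -> R) :=
  bounded_on g /\ forall d N, V (fun z => (g z * L d z ^+ N)%:C).

Definition ridge_multiplier (g : T -> R) :=
  bounded_on g /\ forall h, ridge_module h -> ridge_module (fun z => g z * h z).

Lemma ridge_module_lim g :
  (forall e, 0 < e -> exists2 h, ridge_module h & forall z, B z -> `|h z - g z| <= e) ->
  ridge_module g.
Proof.
move=> gW; split.
  by apply: bounded_on_lim => e /gW [h [hb _] hg]; exists h.
move=> d N; apply: (cs_lim csV) => e e0; have [M M0 LM] := L_bounded d.
have M1 : 0 < M ^+ N + 1 by rewrite ltr_wpDl ?exprn_ge0.
have /gW [h [_ Wh] hg] : 0 < e / (M ^+ N + 1) by rewrite divr_gt0.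
exists (fun z => (h z * L d z ^+ N)%:C) => // z Bz.
rewrite -rmorphB normc_real -mulrBl normrM normrX.
have H1 := hg z Bz; have H2 : `|L d z| ^+ N <= M ^+ N + 1.
  by apply: le_trans (lerXn2r N _ _ (LM z Bz)) _; rewrite ?nnegrE ?lerDl.
apply: le_trans (ler_pM _ _ H1 H2) _; rewrite ?exprn_ge0 //.
by rewrite divfK // gt_eqF.
Qed.

Lemma ridge_multiplier_algebra : closed_algebra ridge_multiplier.
Proof.
split.
- by move=> g [].
- move=> c; split; first exact: bounded_on_cst.
  move=> h [hb hV]; split; first by apply: bounded_on_mul => //; exact: bounded_on_cst.
  move=> d N. refine (cs_ext csV (cs_scale csV c%:C (hV d N)) _) => z _.
  by rewrite -rmorphM mulrA.
- move=> c g h [gb gW] [hb hW]; split; first exact: bounded_on_lin.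
  move=> k Wk; have [gkb gkV] := gW k Wk; have [hkb hkV] := hW k Wk; split.
    by apply: bounded_on_mul; [exact: bounded_on_lin | case: Wk].
  move=> d N; refine (cs_ext csV (cs_lin csV c%:C (gkV d N) (hkV d N)) _) => z _.
  by rewrite -rmorphM -rmorphD; congr (_%:C); ring.
- move=> g h [gb gW] [hb hW]; split; first exact: bounded_on_mul.
  move=> k /hW /gW; congr ridge_module; apply/funext => z; exact: mulrA.
- move=> g gA; split.
    by apply: bounded_on_lim => e /gA [h [hb _] hg]; exists h.
  move=> h Wh; have [[M M0 hM] _] := Wh; apply: ridge_module_lim => e e0.
  have M1 : 0 < M + 1 by rewrite ltr_wpDl.
  have /gA [k [_ kW] kg] : 0 < e / (M + 1) by rewrite divr_gt0.
  exists (fun z => k z * h z); first exact: kW.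
  move=> z Bz; rewrite -mulrBl normrM.
  have H2 : `|h z| <= M + 1 by apply: le_trans (hM z Bz) _; rewrite lerDl.
  apply: le_trans (ler_pM _ _ (kg z Bz) H2) _ => //.
  by rewrite divfK // gt_eqF.
Qed.

(** Expand h (L d' + j L d)^(N+1), which is in V for j = 0, 1, 2, ..., in powers of j
    and isolate the coefficient of j. *)
Lemma ridge_multiplier_form d : ridge_multiplier (L d).
Proof.
split=> // h [hb hV]; split; first exact: bounded_on_mul.
move=> d' N.
pose v k z := (h z * (L d' z ^+ (N.+1 - k) * L d z ^+ k *+ 'C(N.+1, k)))%:C.
have natI : injective (fun j : nat => j%:R : R[i]).
  by move=> j k /eqP; rewrite eqr_nat => /eqP.
have Vv j : V (fun z => \sum_(k < N.+2) j%:R ^+ k * v k z).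
  refine (cs_ext csV (hV (d' + (j%:R)%:C *: d) N.+1) _) => z _.
  rewrite L_lin exprDn mulr_sumr rmorph_sum; apply: eq_bigr => k _.
  rewrite /v -(rmorph_nat (real_complex R)) -rmorphXn -rmorphM; congr (_%:C).
  by rewrite exprMn -[_ *+ 'C(_, _)]mulr_natr -[in RHS](mulr_natr (_ * _)); ring.
have := cs_vandermonde csV natI Vv (isT : 1 < N.+2)%N.
move/(cs_scale csV (N.+1%:R^-1)%:C)/(cs_ext csV); apply => z _.
rewrite /v -rmorphM; congr (_%:C).
rewrite subn1 /= bin1 expr1 -(mulr_natr (_ * _)); field.
by rewrite nat1r pnatr_eq0.
Qed.

(** The constant 1 is in the module. *)
Lemma ridge_multiplier_sub g : ridge_multiplier g -> V (fun z => (g z)%:C).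
Proof.
move=> [_ gW]; have W1 : ridge_module (fun=> 1).
  split; first exact: bounded_on_cst.
  by move=> d N; refine (cs_ext csV (L_powers d N) _) => z _; rewrite mul1r.
have [_ /(_ 0 0%N) /(cs_ext csV)] := gW _ W1; apply => z _.
by rewrite expr0 !mulr1.
Qed.

End ridge_functions.
End closed_algebras.

(** * The Stone-Weierstrass theorem *)

Section stone_weierstrass.
Variable R : realType.

(** For |g| <= 1, the iterates increase to the fixed point |g| of
    p |-> p + (g^2 - p^2) / 2; each is a polynomial in g. *)
Fixpoint abs_iter (g : R) (n : nat) : R :=
  if n is m.+1 then abs_iter g m + (g ^+ 2 - abs_iter g m ^+ 2) / 2 else 0.

(** With a = |g|, the error a - p is multiplied by 1 - (a + p) / 2 <= 1 - a / 2 at each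
    step, and (1 - a / 2) (1 + (n + 1) a / 2) <= 1 + n a / 2.  So the error after n
    steps is at most a / (1 + n a / 2), which is O(1 / n) uniformly in a. *)
Lemma abs_iter_bound g n : `|g| <= 1 -> `| abs_iter g n - `|g| | * n%:R <= 2.
Proof.
move=> g1; set a := `|g| in g1 *.
have a0 : 0 <= a by exact: normr_ge0.
have [p0 pa pn] : [/\ 0 <= abs_iter g n, abs_iter g n <= a &
    (a - abs_iter g n) * (1 + n%:R * (a / 2)) <= a].
  elim: n => [|n [p0 pa IH]] /=; first by rewrite subr0 mul0r addr0 mulr1.
  have -> : g ^+ 2 = a ^+ 2 by rewrite real_normK // num_real.
  set p := abs_iter g n in p0 pa IH *.
  have n0 : 0 <= n%:R :> R by exact: ler0n.
  split; first by nra.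
    have : 0 <= (a - p) * (1 - (a + p) / 2) by apply: mulr_ge0; lra.
    by lra.
  apply: le_trans IH; rewrite -[n.+1%:R]natr1.
  have -> : a - (p + (a ^+ 2 - p ^+ 2) / 2) = (a - p) * (1 - (a + p) / 2) by field.
  rewrite -mulrA; apply: ler_wpM2l; first by rewrite subr_ge0.
  set k : R := n%:R in n0 *; have ka : 0 <= k * a by rewrite mulr_ge0.
  have : 0 <= (1 + (k + 1) * (a / 2)) * p by rewrite mulr_ge0 //; lra.
  have : 0 <= (k + 1) * a ^+ 2 by rewrite mulr_ge0 ?sqr_ge0 //; lra.
  lra.
rewrite distrC ger0_norm ?subr_ge0 //.
have [a_eq0|a_neq0] := eqVneq a 0.
  have -> : a - abs_iter g n = 0 by lra.
  by rewrite mul0r.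
have a_gt0 : 0 < a by rewrite lt_def a_neq0.
have /ler_pM2r <- := a_gt0.
have : 0 <= a - abs_iter g n by rewrite subr_ge0.
lra.
Qed.

Variables (T : topologicalType) (B : set T) (A : set (T -> R)).
Hypothesis caA : closed_algebra B A.

Lemma ca_abs g : A g -> A (fun z => `|g z|).
Proof.
move=> Ag; have [M M0 gM] := ca_bounded caA Ag.
have M1 : 0 < M + 1 by rewrite ltr_wpDl.
pose G z := g z / (M + 1).
have AG : A G.
  have := ca_lin caA (M + 1)^-1 Ag (ca_cst caA 0); congr A.
  by apply/funext => z; rewrite addr0 /G mulrC.
have G1 z : B z -> `|G z| <= 1.
  move=> Bz; rewrite /G normrM normfV [X in _ / X]gtr0_norm //.
  by rewrite ler_pdivrMr // mul1r; apply: le_trans (gM z Bz) _; rewrite lerDl.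
have Ap n : A (fun z => abs_iter (G z) n).
  elim: n => [|n IH] /=; first exact: (ca_cst caA 0).
  have := ca_lin caA (1 / 2) (ca_lin caA (-1) (ca_mul caA IH IH) (ca_mul caA AG AG)) IH.
  by congr A; apply/funext => z; rewrite !expr2; field.
have AGabs : A (fun z => `|G z|).
  apply: (ca_lim caA) => e e0; have [n ne] : exists n : nat, 2 / e < n%:R.
    by exists (Num.bound (2 / e)); apply: archi_boundP; rewrite divr_ge0 // ltW.
  exists (fun z => abs_iter (G z) n) => // z Bz.
  have := abs_iter_bound n (G1 z Bz); rewrite ltr_pdivrMr // in ne.
  have n0 : 0 < n%:R :> R.
    by rewrite -(pmulr_lgt0 _ e0); apply: lt_trans ne.
  by rewrite -ler_pdivlMr // => /le_trans; apply; rewrite ler_pdivrMr // mulrC ltW.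
have := ca_lin caA (M + 1) AGabs (ca_cst caA 0); congr A.
apply/funext => z; rewrite addr0 /G normrM normfV [X in _ / X]gtr0_norm //.
by rewrite mulrCA divff ?mulr1 // gt_eqF.
Qed.

(** If P B fails, the sets whose complement in B satisfies P form a proper filter
    without cluster point in B. *)
Lemma compact_union_induction (P : set T -> Prop) : compact B -> P set0 ->
  (forall E F, P E -> P F -> P (E `|` F)) ->
  (forall E F, E `<=` F -> P F -> P E) ->
  (forall x, B x -> exists2 U, nbhs x U & P (B `&` U)) ->
  P B.
Proof.
move=> cB P0 PU Psub Ploc; apply: contrapT => nPB.
pose F : set_system T := [set S | P (B `\` S)].
have FF : ProperFilter F.
  split; first by rewrite /F /= setD0.
  split.
  - by rewrite /F /= setDT.
  - by move=> S S' FS FS'; rewrite /F /= setDIr; exact: PU.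
  - by move=> S S' SS'; apply: Psub; exact: setDS.
have [|p [Bp clp]] := cB F FF; first by rewrite /F /= setDv.
have [U xU PBU] := Ploc p Bp.
have FU : F (~` U) by rewrite /F /= setDE setCK.
by have [y []] := clp _ _ FU xU.
Qed.

Definition continuous_on (g : T -> R) := forall x, B x -> forall e, 0 < e ->
  \forall y \near x, B y -> `|g y - g x| < e.

Lemma continuous_on_cst c : continuous_on (fun=> c).
Proof. by move=> x Bx e e0; apply: nearW => y _; rewrite subrr normr0. Qed.

Lemma continuous_on_lin c g h : continuous_on g -> continuous_on h ->
  continuous_on (fun z => c * g z + h z).
Proof.
move=> cg ch x Bx e e0; have c1 : 0 < `|c| + 1 by rewrite ltr_wpDl.
have e1 : 0 < e / 2 / (`|c| + 1) by rewrite !divr_gt0.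
have e2 : 0 < e / 2 by rewrite divr_gt0.
near=> y => By.
have Hg : `|g y - g x| < e / 2 / (`|c| + 1) by move: By; near: y; exact: cg.
have Hh : `|h y - h x| < e / 2 by move: By; near: y; exact: ch.
have -> : c * g y + h y - (c * g x + h x) = c * (g y - g x) + (h y - h x) by ring.
apply: le_lt_trans (ler_normD _ _) _; rewrite normrM.
move: Hg; rewrite ltr_pdivlMr // => Hg.
have := normr_ge0 (g y - g x); lra.
Unshelve. all: by end_near. Qed.

Lemma continuous_on_abs g : continuous_on g -> continuous_on (fun z => `|g z|).
Proof.
move=> cg x Bx e e0; have := cg x Bx e e0; apply: filterS => y gy By.
exact: le_lt_trans (ler_dist_dist _ _) (gy By).
Qed.

(* Elements of A may be discontinuous, so the compactness arguments use only those
   that are continuous. *)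
Let Ac g := A g /\ continuous_on g.

Let Ac_lin c g h : Ac g -> Ac h -> Ac (fun z => c * g z + h z).
Proof. by move=> [? ?] [? ?]; split; [exact: (ca_lin caA)|exact: continuous_on_lin]. Qed.

Let Ac_cst c : Ac (fun=> c).
Proof. by split; [exact: (ca_cst caA c)|exact: continuous_on_cst]. Qed.

Let Ac_abs g : Ac g -> Ac (fun z => `|g z|).
Proof. by move=> [? ?]; split; [exact: ca_abs|exact: continuous_on_abs]. Qed.

Let Ac_max g h : Ac g -> Ac h -> Ac (fun z => Num.max (g z) (h z)).
Proof.
move=> Ag Ah; have Agh := Ac_abs (Ac_lin (-1) Ah Ag).
have := Ac_lin (1 / 2) Agh (Ac_lin (1 / 2) Ag (Ac_lin (1 / 2) Ah (Ac_cst 0))).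
congr Ac; apply/funext => z; rewrite mulN1r [- _ + _]addrC.
by case: (leP (g z) (h z)) => gh; [rewrite ler0_norm | rewrite gtr0_norm]; lra.
Qed.

Let Ac_opp g : Ac g -> Ac (fun z => - g z).
Proof.
move=> Ag; have := Ac_lin (-1) Ag (Ac_cst 0); congr Ac.
by apply/funext => z; rewrite addr0 mulN1r.
Qed.

Hypothesis compactB : compact B.
Hypothesis separating : forall x y, B x -> B y -> x <> y ->
  exists g, [/\ A g, continuous_on g & g x <> g y].

Let interpolate f x y : B x -> B y -> exists g, [/\ Ac g, g x = f x & g y = f y].
Proof.
move=> Bx By; have [->|/eqP xy] := eqVneq x y; first by exists (fun=> f y).
have [s [As cs sxy]] := separating Bx By xy.
have s0 : s x - s y != 0 by rewrite subr_eq0; apply/eqP.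
exists (fun z => (f x - f y) / (s x - s y) * s z +
  (f y - (f x - f y) / (s x - s y) * s y)).
by split; [exact: Ac_lin | field | ring].
Qed.

(** Glue by maxima the functions that interpolate f at x and at a second point y. *)
Let above f e x : continuous_on f -> 0 < e -> B x ->
  exists g, [/\ Ac g, g x = f x & forall y, B y -> f y - e < g y].
Proof.
move=> cf e0 Bx.
apply: (@compact_union_induction (fun E => exists g, [/\ Ac g, g x = f x &
  forall y, E y -> f y - e < g y])) => //.
- by exists (fun=> f x).
- move=> E F [g [Ag gx gE]] [h [Ah hx hF]]; exists (fun z => Num.max (g z) (h z)).
  split; [exact: Ac_max | by rewrite gx hx maxxx |].
  by move=> y [/gE|/hF] yl; rewrite lt_max yl // orbT.
- by move=> E F EF [g [Ag gx gF]]; exists g; split=> // y /EF; exact: gF.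
move=> y By; have [g [Ag gx gy]] := interpolate f Bx By.
have e2 : 0 < e / 2 by rewrite divr_gt0.
exists [set u | B u -> f u - e < g u]; last by exists g; split=> // u [Bu]; exact.
have [_ cg] := Ag; near=> u => Bu.
have : `|g u - g y| < e / 2 by move: Bu; near: u; exact: cg.
have : `|f u - f y| < e / 2 by move: Bu; near: u; exact: cf.
by rewrite gy !ltr_norml; lra.
Unshelve. all: by end_near. Qed.

(** Glue by minima the functions of [above] that agree with f at x, when x varies. *)
Lemma stone_weierstrass f : continuous_on f -> A f.
Proof.
move=> cf; apply: (ca_lim caA) => e e0.
have [Bne|nB] := pselect (B !=set0); last first.
  exists (fun=> 0) => [|z Bz]; first exact: (ca_cst caA 0).
  by exfalso; apply: nB; exists z.
suff [g [[Ag _] g1 g2]] : exists g, [/\ Ac g, forall y, B y -> f y - e < g y &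
    forall y, B y -> g y < f y + e].
  exists g => // z Bz; have := g1 z Bz; have := g2 z Bz.
  by rewrite ler_norml; lra.
apply: (@compact_union_induction (fun E => exists g, [/\ Ac g,
  forall y, B y -> f y - e < g y & forall y, E y -> g y < f y + e])) => //.
- have [x Bx] := Bne; have [g [Ag _ g1]] := above cf e0 Bx.
  by exists g; split.
- move=> E F [g [Ag g1 gE]] [h [Ah h1 hF]].
  exists (fun z => - Num.max (- g z) (- h z)); split.
  + by apply: Ac_opp; apply: Ac_max; exact: Ac_opp.
  + by move=> y By; rewrite oppr_max !opprK lt_min g1 ?h1.
  + by move=> y [/gE|/hF] yl; rewrite oppr_max !opprK gt_min yl ?orbT.
- by move=> E F EF [g [Ag gx gF]]; exists g; split=> // y /EF; exact: gF.
move=> x Bx; have [g [Ag gx g1]] := above cf e0 Bx.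
have e2 : 0 < e / 2 by rewrite divr_gt0.
exists [set u | B u -> g u < f u + e]; last by exists g; split=> // u [Bu]; exact.
have [_ cg] := Ag; near=> u => Bu.
have : `|g u - g x| < e / 2 by move: Bu; near: u; exact: cg.
have : `|f u - f x| < e / 2 by move: Bu; near: u; exact: cf.
by rewrite gx !ltr_norml; lra.
Unshelve. all: by end_near. Qed.

End stone_weierstrass.

(** * Topology of complex vectors *)

Section complex_topology.
Variable R : realType.
Notation C := R[i].

Lemma nbhs_normcP (x : C) (P : set C) :
  nbhs x P <-> exists2 e : R, 0 < e & forall y, normc (x - y) < e -> P y.
Proof.
have normE (y : C) : `|y| = (normc y)%:C by rewrite normc_def; case: y.
split.
  move=> /nbhs_ballP [e /= e0 eP]; exists (complex.Re e).
    by move: e0; rewrite ltcE => /andP[_].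
  move=> y xy; apply: eP; rewrite /ball /= normE ltcE /= xy.
  by move: e0; rewrite ltcE /= => /andP[/eqP -> _]; rewrite eqxx.
move=> [e e0 eP]; apply/nbhs_ballP; exists e%:C; first by rewrite /= ltcR.
by move=> y; rewrite /ball /= normE ltcR => /eP.
Qed.

Lemma near_normc (x : C) e : 0 < e -> \forall y \near x, normc (x - y) < e.
Proof. by move=> e0; apply/nbhs_normcP; exists e. Qed.

Lemma Re_le_normc (x : C) : `|complex.Re x| <= normc x.
Proof.
case: x => a b /=; rewrite -sqrtr_sqr ler_wsqrtr // lerDl; exact: sqr_ge0.
Qed.

Lemma Im_le_normc (x : C) : `|complex.Im x| <= normc x.
Proof.
case: x => a b /=; rewrite -sqrtr_sqr ler_wsqrtr // lerDr; exact: sqr_ge0.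
Qed.

Lemma normc_le_ReIm (x : C) : normc x <= `|complex.Re x| + `|complex.Im x|.
Proof.
rewrite {1}[x]complexE; apply: le_trans (le_normcD _ _) _.
rewrite normcM !normc_real.
have -> : normc 'i%C = 1 :> R by rewrite /= expr0n expr1n add0r sqrtr1.
by rewrite mul1r.
Qed.

Lemma Re_continuous : continuous (@complex.Re R).
Proof.
move=> x; apply/(cvgrPdist_lt (F := nbhs x)) => e e0; near=> y.
apply: (@le_lt_trans _ _ (normc (x - y))); last by near: y; exact: near_normc.
by rewrite (le_trans _ (Re_le_normc _)) // raddfB.
Unshelve. all: by end_near. Qed.

Lemma Im_continuous : continuous (@complex.Im R).
Proof.
move=> x; apply/(cvgrPdist_lt (F := nbhs x)) => e e0; near=> y.
apply: (@le_lt_trans _ _ (normc (x - y))); last by near: y; exact: near_normc.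
by rewrite (le_trans _ (Im_le_normc _)) // raddfB.
Unshelve. all: by end_near. Qed.

Variable n : nat.

Lemma entry_continuous (i : 'I_n) : continuous (fun z : 'cV[C]_n => z i 0).
Proof. exact: coord_continuous. Qed.

Lemma enorm_ge0 (z : 'cV[C]_n) : 0 <= enorm z.
Proof. exact: sqrtr_ge0. Qed.

Lemma enorm_sqr (z : 'cV[C]_n) : enorm z ^+ 2 = \sum_(i < n) normc (z i 0) ^+ 2.
Proof. by rewrite sqr_sqrtr // sumr_ge0 // => i _; rewrite sqr_ge0. Qed.

Lemma normc_entry_le (z : 'cV[C]_n) i : normc (z i 0) <= enorm z.
Proof.
rewrite -(ler_pXn2r (n := 2)) ?nnegrE ?normc_ge0 ?enorm_ge0 // enorm_sqr.
by rewrite (bigD1 i) //= lerDl sumr_ge0 // => j _; rewrite sqr_ge0.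
Qed.

Lemma normc_sqr (x : C) : normc x ^+ 2 = complex.Re x ^+ 2 + complex.Im x ^+ 2.
Proof. by case: x => a b; rewrite sqr_sqrtr // addr_ge0 ?sqr_ge0. Qed.

Lemma cballE r : 0 <= r -> cball r =
  [set z : 'cV[C]_n |
    \sum_(i < n) (complex.Re (z i 0) ^+ 2 + complex.Im (z i 0) ^+ 2) <= r ^+ 2].
Proof.
move=> r0; apply/funext => z; rewrite /cball /mkset; congr is_true.
rewrite -(@ler_pXn2r _ 2) ?nnegrE ?enorm_ge0 // enorm_sqr.
by congr (_ <= _); apply: eq_bigr => i _; exact: normc_sqr.
Qed.

Lemma cball_closed r : 0 <= r -> closed (cball r : set 'cV[C]_n).
Proof.
move=> r0; rewrite cballE //.
have ct : continuous (fun z : 'cV[C]_n =>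
    \sum_(i < n) (complex.Re (z i 0) ^+ 2 + complex.Im (z i 0) ^+ 2)).
  apply: continuous_big => [|i _ z]; first exact: add_continuous.
  have cRe : {for z, continuous (fun z : 'cV[C]_n => complex.Re (z i 0))}.
    by apply: continuous_comp; [exact: entry_continuous | exact: Re_continuous].
  have cIm : {for z, continuous (fun z : 'cV[C]_n => complex.Im (z i 0))}.
    by apply: continuous_comp; [exact: entry_continuous | exact: Im_continuous].
  have sqr_cont (h : 'cV[C]_n -> R) : {for z, continuous h} ->
      {for z, continuous (fun z => h z ^+ 2)}.
    by move=> ch; exact: (continuous_comp ch (@exprn_continuous R 2 _)).
  exact: (cvgD (sqr_cont _ cRe) (sqr_cont _ cIm)).
by have /continuous_closedP/(_ _ (@closed_le R (r ^+ 2))) := ct.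
Qed.

Lemma square_compact r :
  compact [set x : C | `|complex.Re x| <= r /\ `|complex.Im x| <= r].
Proof.
pose mk (p : R * R) : C := p.1 +i* p.2.
have cmk : continuous mk.
  move=> [a b] U /nbhs_normcP [e e0 eU].
  have e2 : 0 < e / 2 by rewrite divr_gt0.
  have near_dist (x : R) : \forall y \near x, `|x - y| < e / 2.
    by have /cvgrPdist_lt := @cvg_id _ (nbhs x); exact.
  exists ([set y | `|a - y| < e / 2], [set y | `|b - y| < e / 2]) => /=.
    by split; exact: near_dist.
  move=> [x y] /= [ax bx]; apply: eU.
  by apply: le_lt_trans (normc_le_ReIm _) _ => /=; lra.
rewrite (_ : mkset _ = mk @` (`[- r, r] `*` `[- r, r])).
  apply: continuous_compact; first exact: continuous_subspaceT.
  by apply: compact_setX; exact: segment_compact.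
apply/seteqP; split=> [[a b] /= [ar br]|_ [[a b] /= [+ +]] <- /=].
  by exists (a, b) => //=; rewrite !in_itv /= -!ler_norml.
by rewrite !in_itv /= -!ler_norml.
Qed.

(** The ball is closed in a product of squares; rows carry the product compactness
    theorem, so the product is transposed. *)
Lemma cball_compact r : 0 <= r -> compact (cball r : set 'cV[C]_n).
Proof.
move=> r0; pose Q := [set x : C | `|complex.Re x| <= r /\ `|complex.Im x| <= r].
have cQ := @rV_compact C n (fun=> Q) (fun=> @square_compact r).
have ct : continuous (fun v : 'rV[C]_n => v^T).
  move=> v U [E Env EU]; exists (fun i j => E j i).
    by move=> i j; have := Env j i; rewrite mxE.
  by move=> w wE; apply: EU => i j; rewrite mxE; exact: wE.
apply: (subclosed_compact (cball_closed r0)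
  (continuous_compact (continuous_subspaceT ct) cQ)).
move=> z zr; exists z^T; last exact: trmxK.
move=> i; rewrite mxE /Q /=; have zi := le_trans (normc_entry_le z i) zr.
by split; apply: le_trans zi; [exact: Re_le_normc | exact: Im_le_normc].
Qed.

Lemma within_continuousP (T : topologicalType) (B : set T) (g : T -> R) :
  {within B, continuous g} <-> continuous_on B g.
Proof.
rewrite subspace_continuousP; split.
  move=> cg x Bx e e0; have /cvgrPdist_lt/(_ e e0) := cg x Bx.
  by apply: filterS => y; rewrite distrC.
move=> cg x Bx; apply/cvgrPdist_lt => e e0; have := cg x Bx e e0.
by apply: filterS => y; rewrite distrC.
Qed.

End complex_topology.

(** * Measurability of complex functions *)

Section complex_measurability.
Context d (T : measurableType d) (R : realType).
Notation C := R[i].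
Implicit Types h : T -> C.

Definition measurable_complex h :=
  measurable_fun setT (fun t => complex.Re (h t)) /\
  measurable_fun setT (fun t => complex.Im (h t)).

Lemma measurable_complex_cst c : measurable_complex (fun=> c).
Proof. by split; exact: measurable_cst. Qed.

Lemma measurable_complexD h1 h2 : measurable_complex h1 -> measurable_complex h2 ->
  measurable_complex (fun t => h1 t + h2 t).
Proof.
move=> [r1 i1] [r2 i2]; split.
  rewrite (_ : (fun t => _) =
      (fun t => complex.Re (h1 t)) \+ (fun t => complex.Re (h2 t))).
    exact: measurable_funD.
  by apply/funext => t /=; rewrite raddfD.
rewrite (_ : (fun t => _) =
    (fun t => complex.Im (h1 t)) \+ (fun t => complex.Im (h2 t))).
  exact: measurable_funD.
by apply/funext => t /=; rewrite raddfD.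
Qed.

Lemma measurable_complexZ c h : measurable_complex h ->
  measurable_complex (fun t => c * h t).
Proof.
have mZ (k : R) (g : T -> R) : measurable_fun setT g ->
    measurable_fun setT (fun t => k * g t).
  by move=> mg; exact: (measurable_funM (measurable_cst k) mg).
move=> [r i]; split.
  rewrite (_ : (fun t => _) = (fun t => complex.Re c * complex.Re (h t)) \-
      (fun t => complex.Im c * complex.Im (h t))).
    by apply: measurable_funB; exact: mZ.
  by apply/funext => t /=; case: c (h t) => ? ? [].
rewrite (_ : (fun t => _) = (fun t => complex.Re c * complex.Im (h t)) \+
    (fun t => complex.Im c * complex.Re (h t))).
  by apply: measurable_funD; exact: mZ.
by apply/funext => t /=; case: c (h t) => ? ? [].
Qed.

Lemma measurable_complex_sum I (r : seq I) (h : I -> T -> C) :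
  (forall j, measurable_complex (h j)) ->
  measurable_complex (fun t => \sum_(j <- r) h j t).
Proof.
move=> mh; elim: r => [|j r IH].
  rewrite (_ : (fun t => _) = fun=> 0); first exact: measurable_complex_cst.
  by apply/funext => t; rewrite big_nil.
rewrite (_ : (fun t => _) = fun t => h j t + \sum_(k <- r) h k t).
  exact: measurable_complexD.
by apply/funext => t; rewrite big_cons.
Qed.

(** An open set is the union of the countably many rational open squares inside it,
    and the preimage of a square involves the two real coordinates separately. *)
Lemma measurable_preimage_open h (U : set C) : measurable_complex h -> open U ->
  measurable (h @^-1` U).
Proof.
move=> [mr mi] oU.
pose sq (p q s : rat) : set C := [set x |
  `|complex.Re x - ratr p| < ratr s /\ `|complex.Im x - ratr q| < ratr s].
rewrite (_ : h @^-1` U = \bigcup_(p : rat) \bigcup_(q : rat) \bigcup_(s : rat)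
    if `[< sq p q s `<=` U >] then h @^-1` sq p q s else set0).
  apply: bigcupT_measurable_rat => p; apply: bigcupT_measurable_rat => q.
  apply: bigcupT_measurable_rat => s; case: ifP => // _.
  have mray (g : T -> R) (c e : R) : measurable_fun setT g ->
      measurable [set t | `|g t - c| < e].
    move=> mg; have := mg measurableT _ (measurable_itv `]c - e, c + e[).
    rewrite setTI; congr measurable; apply/seteqP; split=> t /=;
      rewrite in_itv /= ltr_distl //.
  rewrite (_ : h @^-1` sq p q s = [set t | `|complex.Re (h t) - ratr p| < ratr s] `&`
    [set t | `|complex.Im (h t) - ratr q| < ratr s]) //.
  by apply: measurableI; exact: mray.
apply/seteqP; split=> t; last first.
  by move=> [p _ [q _ [s _]]]; case: ifP => // /asboolP sqU /sqU.
rewrite /preimage /= => Uht.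
have /nbhs_normcP [e e0 eU] : nbhs (h t) U by exact: open_nbhs_nbhs.
have [s] : exists s : rat, ratr s \in `]0, e / 4[.
  by apply: rat_in_itvoo; rewrite divr_gt0.
rewrite in_itv /= => /andP[s0 se].
have near_rat (x : R) : exists p : rat, `|x - ratr p| < ratr s.
  have [|p] := @rat_in_itvoo R (x - ratr s) (x + ratr s); first lra.
  by rewrite in_itv /= => /andP[? ?]; exists p; rewrite ltr_norml; lra.
have [p ps] := near_rat (complex.Re (h t)).
have [q qs] := near_rat (complex.Im (h t)).
exists p => //; exists q => //; exists s => //.
rewrite ifT //; apply/asboolP => y [yp yq]; apply: eU.
apply: le_lt_trans (normc_le_ReIm _) _; rewrite !raddfB.
move: ps qs yp yq; rewrite !ltr_norml => /andP[? ?] /andP[? ?] /andP[? ?] /andP[? ?].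
have : `|complex.Re (h t) - complex.Re y| < 2 * ratr s by rewrite ltr_norml; lra.
have : `|complex.Im (h t) - complex.Im y| < 2 * ratr s by rewrite ltr_norml; lra.
lra.
Qed.

Lemma measurable_continuous_open h (U : set C) (g : C -> R) :
  measurable_complex h -> open U -> {within U, continuous g} ->
  (forall x, ~ U x -> g x = 0) ->
  measurable_fun setT (g \o h).
Proof.
move=> mh oU /subspace_continuousP cg g0.
apply: (measurability _ (RGenOInfty.measurableE R)) => // _ [_ [a ->] <-].
rewrite setTI.
have oUa : open (U `&` [set x | a < g x]).
  rewrite openE => x [Ux ax]; rewrite /interior.
  have /(cvgrPdist_lt (F := within U (nbhs x))) := cg x Ux.
  move=> /(_ (g x - a)); rewrite subr_gt0 => /(_ ax) near_g.
  have nU : nbhs x U by exact: open_nbhs_nbhs.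
  move: near_g; rewrite /within /= => near_g.
  apply: filterS (filterI nU near_g) => y [Uy /(_ Uy) gy]; split=> //=.
  by move: gy; rewrite ltr_norml => /andP[_]; rewrite ltrD2l ltrN2.
rewrite (_ : _ @^-1` _ = h @^-1` (U `&` [set x | a < g x]) `|`
   (if a < 0 then ~` (h @^-1` U) else set0)).
  apply: measurableU; first exact: measurable_preimage_open.
  by case: ifP => // _; apply: measurableC; exact: measurable_preimage_open.
apply/seteqP; split=> t /=; rewrite in_itv /= andbT.
  move=> ag; have [Ut|nUt] := pselect (U (h t)); first by left.
  by right; move: ag; rewrite g0 // => ->.
move=> [[]//|]; case: ifP => // a0 nU; rewrite g0 //.
Qed.

End complex_measurability.

Section measurable_column_vectors.
Variables (R : realType) (n : nat).
Notation C := R[i].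

Lemma measurable_entry (i : 'I_n) : measurable_complex (fun z : 'cV[C]_n => z i 0).
Proof.
have mR : measurable_fun setT (@R_of_C R n).
  by move=> _ Y mY; exists Y => //; rewrite !setTI.
have mk (k : 'I_(n + n)) : measurable_fun setT (fun z : 'cV[C]_n => tnth (R_of_C z) k).
  exact: (measurableT_comp (measurable_tnth k) mR).
split.
  have := mk (lshift n i); congr measurable_fun; apply/funext => z.
  by rewrite tnth_mktuple (unsplitK (inl i)).
have := mk (rshift n i); congr measurable_fun; apply/funext => z.
by rewrite tnth_mktuple (unsplitK (inr i)).
Qed.

Lemma measurable_column d (T : measurableType d) (h : T -> 'cV[C]_n) :
  (forall k, measurable_complex (fun t => h t k 0)) -> measurable_fun setT h.
Proof.
move=> mh _ _ [Y mY <-]; rewrite !setTI -comp_preimage.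
have : measurable_fun setT (@R_of_C R n \o h).
  apply/measurable_fun_tnthP => k.
  have [mr mi] : measurable_complex (fun t =>
      h t (match fintype.split k with inl i => i | inr i => i end) 0) by exact: mh.
  case E : (fintype.split k) mr mi => [i|i] mr mi.
    move: mr; congr measurable_fun; apply/funext => t.
    by rewrite /= tnth_mktuple E.
  move: mi; congr measurable_fun; apply/funext => t.
  by rewrite /= tnth_mktuple E.
by move=> /(_ measurableT Y mY); rewrite setTI.
Qed.

Lemma cball_measurable r : 0 <= r -> measurable (cball r : set 'cV[C]_n).
Proof.
move=> r0; rewrite cballE //.
have mf : measurable_fun setT (fun z : 'cV[C]_n =>
    \sum_(i < n) (complex.Re (z i 0) ^+ 2 + complex.Im (z i 0) ^+ 2)).
  apply: measurable_sum => i; have [mr mi] := measurable_entry i.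
  by apply: measurable_funD; exact: measurable_funX.
have := mf measurableT _ (measurable_itv `]-oo, r ^+ 2]).
by rewrite setTI; congr measurable; apply/funext => z; rewrite /= in_itv.
Qed.

End measurable_column_vectors.

(** * Networks with one hidden layer *)

Section shallow_networks.
Variables (R : realType) (n : nat).
Notation C := R[i].

Definition linear_form (a : 'rV[C]_n) (z : 'cV[C]_n) : C := \sum_(i < n) a 0 i * z i 0.

Lemma linear_formZ c a z : linear_form (c *: a) z = c * linear_form a z.
Proof. by rewrite mulr_sumr; apply: eq_bigr => i _; rewrite mxE mulrA. Qed.

Lemma linear_formD a b z : linear_form (a + b) z = linear_form a z + linear_form b z.
Proof. by rewrite -big_split; apply: eq_bigr => i _; rewrite mxE mulrDl. Qed.

Lemma linear_form_delta i z : linear_form (delta_mx 0 i) z = z i 0.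
Proof.
rewrite /linear_form (bigD1 i) //= big1 ?addr0 => [|j ji].
  by rewrite mxE !eqxx mul1r.
by rewrite mxE (negPf ji) andbF mul0r.
Qed.

Lemma linear_form_bound a r z : cball r z ->
  normc (linear_form a z) <= (\sum_(i < n) normc (a 0 i)) * r.
Proof.
move=> zr; apply: le_trans (normc_sum _ _ _) _; rewrite mulr_suml.
apply: ler_sum => i _; rewrite normcM; apply: ler_wpM2l; first exact: normc_ge0.
exact: le_trans (normc_entry_le z i) zr.
Qed.

Variables (ell : R) (rho : C -> C) (B : set 'cV[C]_n).

(** Output weight, input weights, bias. *)
Definition neuron : Type := (C * 'rV[C]_n * C)%type.

Definition neuron_input (nu : neuron) (z : 'cV[C]_n) : C := linear_form nu.1.2 z + nu.2.

Definition admissible (s : seq neuron) :=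
  forall nu, nu \in s -> forall z, B z -> pdisc ell (neuron_input nu z).

Definition shallow_sum (s : seq neuron) (z : 'cV[C]_n) : C :=
  \sum_(nu <- s) nu.1.1 * rho (neuron_input nu z).

Definition shallow_limit (g : 'cV[C]_n -> C) := forall e, 0 < e ->
  exists2 s, admissible s & forall z, B z -> normc (shallow_sum s z - g z) <= e.

Lemma shallow_limit_closed : closed_subspace B shallow_limit.
Proof.
split.
- move=> e e0; exists [::] => // z _.
  by rewrite /shallow_sum big_nil subrr normc0 ltW.
- move=> c g h Vg Vh e e0.
  have c1 : 0 < normc c + 1 by rewrite ltr_wpDl ?normc_ge0.
  have e1 : 0 < e / 2 / (normc c + 1) by rewrite !divr_gt0.
  have e2 : 0 < e / 2 by rewrite divr_gt0.
  have [s sB sg] := Vg _ e1; have [t tB th] := Vh _ e2.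
  exists ([seq ((c * nu.1.1, nu.1.2), nu.2) | nu <- s] ++ t).
    move=> nu; rewrite mem_cat => /orP[/mapP[nu' nus ->]|/tB //].
    exact: sB nus.
  move=> z Bz; rewrite /shallow_sum big_cat big_map /=.
  have -> : \sum_(nu <- s)
      c * nu.1.1 * rho (neuron_input (c * nu.1.1, nu.1.2, nu.2) z) = c * shallow_sum s z.
    by rewrite mulr_sumr; apply: eq_bigr => nu _; rewrite mulrA.
  have -> : c * shallow_sum s z + \sum_(nu <- t) nu.1.1 * rho (neuron_input nu z) -
      (c * g z + h z) = c * (shallow_sum s z - g z) + (shallow_sum t z - h z).
    by rewrite /shallow_sum; ring.
  apply: le_trans (le_normcD _ _) _; rewrite normcM.
  have := sg z Bz; rewrite ler_pdivlMr // => H1; have := th z Bz => H2.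
  have := normc_ge0 (shallow_sum s z - g z); nra.
- move=> g Vg e e0; have e2 : 0 < e / 2 by rewrite divr_gt0.
  have [h Vh hg] := Vg _ e2; have [s sB sh] := Vh _ e2.
  exists s => // z Bz.
  have -> : shallow_sum s z - g z = (shallow_sum s z - h z) + (h z - g z) by ring.
  apply: le_trans (le_normcD _ _) _; have := hg z Bz; have := sh z Bz; lra.
Qed.

Hypothesis ell0 : 0 < ell.
Variable k : C.
Hypothesis rho_phase : forall e, 0 < e -> exists2 eta, 0 < eta &
  forall x, pdisc ell x -> normc x < eta -> normc (k * rho x - phase x) <= e.

Lemma phase_scale (t : R) x : 0 < t -> phase (t%:C * x) = phase x.
Proof.
move=> t0; rewrite /phase normcM normc_real gtr0_norm // rmorphM /=.
by rewrite -mulf_div divff ?mul1r // fmorph_eq0 gt_eqF.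
Qed.

(** A single neuron suffices: phase is invariant under positive scaling, so
    k rho (t (1 + d z)) is close to phase (1 + d z) when t is small.  As |d z| <= 1/2,
    the input of this neuron stays away from 0. *)
Lemma shallow_limit_phase d : (forall z, B z -> normc (linear_form d z) <= 1 / 2) ->
  shallow_limit (fun z => phase (1 + linear_form d z)).
Proof.
move=> dB e e0; have [eta eta0 rho_eta] := rho_phase e0.
pose t := Num.min ell eta / 2.
have t0 : 0 < t by rewrite divr_gt0 // lt_min ell0.
have tell : t * 2 <= ell by rewrite divfK // ge_min lexx.
have teta : t * 2 <= eta by rewrite divfK // ge_min lexx orbT.
have tin z : neuron_input ((k, t%:C *: d), t%:C) z = t%:C * (1 + linear_form d z).
  by rewrite /neuron_input linear_formZ mulrDr mulr1 addrC.
have nin z : B z -> 0 < normc (t%:C * (1 + linear_form d z)) < t * 2.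
  move=> /dB dz; rewrite normcM normc_real gtr0_norm // pmulr_rgt0 // ltr_pM2l //.
  have := le_normcD 1 (linear_form d z).
  have := normc_distl 1 (- linear_form d z).
  by rewrite opprK normcN normc1 ler_norml; lra.
exists [:: ((k, t%:C *: d), t%:C)].
  move=> nu; rewrite inE => /eqP -> z /nin; rewrite tin /pdisc /= => /andP[-> /=].
  by move=> /lt_le_trans; apply.
move=> z /nin /andP[n0 nt]; rewrite /shallow_sum big_seq1 tin.
rewrite -(phase_scale (1 + _) t0); apply: rho_eta.
  by rewrite /pdisc /= n0 /=; apply: lt_le_trans tell.
exact: lt_le_trans teta.
Qed.

End shallow_networks.

(** * Universal approximation of scalar functions *)

Section universal_approximation.
Variables (R : realType) (n : nat) (ell rad : R) (rho : R[i] -> R[i]) (k : R[i]).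
Notation C := R[i].
Hypotheses (ell0 : 0 < ell) (rad0 : 0 <= rad).
Hypothesis rho_phase : forall e, 0 < e -> exists2 eta, 0 < eta &
  forall x, pdisc ell x -> normc x < eta -> normc (k * rho x - phase x) <= e.

Let B : set 'cV[C]_n := cball rad.
Let V := shallow_limit ell rho B.
Let csV : closed_subspace B V := shallow_limit_closed ell rho B.

Let real_form (d : 'rV[C]_n) (z : 'cV[C]_n) : R := complex.Re (linear_form d z).

Let real_form_lin d d' t z :
  real_form (d + t%:C *: d') z = real_form d z + t * real_form d' z.
Proof.
rewrite /real_form linear_formD linear_formZ raddfD /=.
by case: (linear_form d' z) => a b /=; rewrite mul0r subr0.
Qed.

Let real_form_bounded d : bounded_on B (real_form d).
Proof.
exists ((\sum_(i < n) normc (d 0 i)) * rad).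
  by rewrite mulr_ge0 // sumr_ge0 // => i _; exact: normc_ge0.
by move=> z Bz; apply: le_trans (Re_le_normc _) (linear_form_bound d Bz).
Qed.

(** 2 Re w = w + conj w, and every w^m (conj w)^l is a limit by [cs_monomials]. *)
Let real_form_powers d N : V (fun z => (real_form d z ^+ N)%:C).
Proof.
pose M := (\sum_(i < n) normc (d 0 i)) * rad + 1.
have M0 : 0 < M.
  rewrite ltr_wpDl // mulr_ge0 // sumr_ge0 // => i _; exact: normc_ge0.
have dM z : B z -> normc (linear_form d z) <= M.
  by move=> Bz; apply: le_trans (linear_form_bound d Bz) _; rewrite lerDl.
have Vph s : normc s * M <= 1 / 2 -> V (fun z => phase (1 + s * linear_form d z)).
  move=> sM; rewrite (_ : (fun z => _) = fun z => phase (1 + linear_form (s *: d) z)).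
    apply: (shallow_limit_phase ell0 rho_phase) => z Bz; rewrite linear_formZ normcM.
    by apply: le_trans sM; apply: ler_wpM2l; [exact: normc_ge0 | exact: dM].
  by apply/funext => z; rewrite linear_formZ.
have Vmon := cs_monomials csV M0 dM Vph.
have Vsum : V (fun z => \sum_(j < N.+1) ('C(N, j)%:R : C) *
    (linear_form d z ^+ (N - j) * (linear_form d z)^*%C ^+ j)).
  by apply: (cs_sum csV) => j _; exact: Vmon.
refine (cs_ext csV (cs_scale csV (2 ^- N) Vsum) _) => z _.
rewrite rmorphXn /= ReJ_add expr_div_n mulrC [(_ + _^*%C) ^+ _]exprDn; congr (_ / _).
by apply: eq_bigr => j _; rewrite mulr_natl.
Qed.

Let A := ridge_multiplier B V real_form.
Let caA : closed_algebra B A := ridge_multiplier_algebra csV real_form_bounded.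

Let A_form d : A (real_form d).
Proof. exact: ridge_multiplier_form. Qed.

Let real_form_continuous d : continuous_on B (real_form d).
Proof.
have entry j : continuous_on B (fun z => complex.Re (z j 0)) /\
    continuous_on B (fun z => complex.Im (z j 0)).
  have cj : {within B, continuous (fun z : 'cV[C]_n => z j 0)}.
    exact: continuous_subspaceT (@entry_continuous R n j).
  split; apply/within_continuousP.
    apply: (@within_continuous_comp _ _ _ _ _ (@complex.Re R) _ cj) => x _.
    exact: Re_continuous.
  apply: (@within_continuous_comp _ _ _ _ _ (@complex.Im R) _ cj) => x _.
  exact: Im_continuous.
have sumc (r : seq 'I_n) :
    continuous_on B (fun z => complex.Re (\sum_(j <- r) d 0 j * z j 0)).
  elim: r => [|j r IH].
    rewrite (_ : (fun z => _) = fun=> 0); first exact: continuous_on_cst.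
    by apply/funext => z; rewrite big_nil.
  have [cRe cIm] := entry j.
  have := continuous_on_lin (complex.Re (d 0 j)) cRe
    (continuous_on_lin (- complex.Im (d 0 j)) cIm IH).
  congr continuous_on; apply/funext => z; rewrite big_cons raddfD /=.
  by case: (d 0 j) (z j 0) => a b [x y] /=; ring.
exact: sumc.
Qed.

Lemma shallow_real_universal (g : 'cV[C]_n -> R) :
  continuous_on B g -> V (fun z => (g z)%:C).
Proof.
move=> cg; apply: (ridge_multiplier_sub csV real_form_powers).
apply: (stone_weierstrass caA) cg; first exact: cball_compact.
move=> x y Bx By xy.
have [j xyj] : exists j, x j 0 <> y j 0.
  apply: contrapT => nxy; apply: xy; apply/colP => j; apply: contrapT => xyj.
  by apply: nxy; exists j.
have [Rexy|Rexy] := pselect (complex.Re (x j 0) = complex.Re (y j 0)); last first.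
  exists (real_form (delta_mx 0 j)); split=> //.
  by rewrite /real_form !linear_form_delta.
(* The real part of - i z_j is the imaginary part of z_j. *)
exists (real_form (- 'i%C *: delta_mx 0 j)); split=> //.
rewrite /real_form !linear_formZ !linear_form_delta.
case: (x j 0) (y j 0) xyj Rexy => [a b] [a' b'] /= xyj aa'.
rewrite !oppr0 !mul0r !sub0r !mulN1r !opprK => bb'; apply: xyj.
by rewrite aa' bb'.
Qed.

Lemma shallow_universal (g : 'cV[C]_n -> C) :
  continuous_on B (fun z => complex.Re (g z)) ->
  continuous_on B (fun z => complex.Im (g z)) -> V g.
Proof.
move=> /shallow_real_universal VRe /shallow_real_universal VIm.
refine (cs_ext csV (cs_lin csV 'i%C VIm VRe) _) => z _.
by rewrite addrC -complexE.
Qed.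

End universal_approximation.

(** * The activation function near the origin *)

Section activation.
Variables (R : realType) (alpha mu delta : R) (u : 'cV[R[i]]_2).
Notation C := R[i].
Hypothesis mu1 : 1 < mu.
Hypotheses (u0 : u != 0) (u_lin : normc (u 0 0) = normc (u 1 0)).

Lemma linear_polarization_neq0 : u 0 0 != 0.
Proof.
apply: contraNneq u0 => u00; apply/eqP/colP => i; rewrite mxE.
have u10 : u 1 0 = 0 by apply: eq0_normc; rewrite -u_lin u00 normc0.
have [->|] := eqVneq i 0; first exact: u00.
by case: i => [[|[|//]] //] ? _; rewrite -[RHS]u10; congr (u _ _); apply/val_inj.
Qed.

Lemma normc_expi (t : R) : normc (expi t) = 1.
Proof. by rewrite /= cos2Dsin2 sqrtr1. Qed.

(** Since |u_-| = |u_+|, the leading coefficient of the mode +X is a positive multiple of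
    u.  Comparing first components, rho x / phase x tends to s t / |u_-| as x tends to 0,
    where s is the constant phase factor of the expansion and t = sqrt ((mu - 1) / 2);
    the constant k is the inverse of this limit. *)
Lemma activation_phase (ell : R) (E r : C -> 'cV[C]_2) (rho : C -> C) :
  (forall x, pdisc ell x -> E x = (expi (- carg (1 +i* alpha)) * phase x) *:
     (lead mu delta u JXp + (normc x)%:C *: what mu delta alpha u JXp + r x)) ->
  enorm (r x) / normc x @[x --> (0 : C)^'] --> (0 : R) ->
  (forall x, pdisc ell x -> E x = rho x *: u) ->
  exists k, forall e, 0 < e -> exists2 eta, 0 < eta &
    forall x, pdisc ell x -> normc x < eta -> normc (k * rho x - phase x) <= e.
Proof.
move=> E_exp r_o E_rho; have u00 := linear_polarization_neq0.
set s := expi (- carg (1 +i* alpha)) in E_exp.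
have s1 : normc s = 1 by exact: normc_expi.
have s0 : s != 0 by rewrite -normc_gt0 s1.
pose t := Num.sqrt ((mu - 1) / 2).
have t0 : 0 < t by rewrite sqrtr_gt0 divr_gt0 // subr_gt0.
have nu0 : 0 < normc (u 0 0) by rewrite normc_gt0.
pose w := what mu delta alpha u JXp 0 0.
have tC : t%:C != 0 by rewrite fmorph_eq0 gt_eqF.
have nuC : (normc (u 0 0))%:C != 0 by rewrite fmorph_eq0 gt_eqF.
exists ((normc (u 0 0))%:C / (s * t%:C)) => e e0.
have w1 : 0 < normc w + 1 by rewrite ltr_wpDl ?normc_ge0.
have [d d0 rd] : exists2 d, 0 < d &
    forall x, pdisc ell x -> normc x < d -> enorm (r x) <= normc x.
  have /(cvgrPdist_lt (F := (0 : C)^')) /(_ 1 ltr01) := r_o.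
  move=> /nbhs_normcP [d d0 dr]; exists d => // x /andP[x0 _] xd.
  have := dr x; rewrite sub0r normcN => /(_ xd).
  rewrite -normc_gt0 x0 => /(_ isT); rewrite sub0r normrN.
  rewrite ger0_norm ?divr_ge0 ?enorm_ge0 ?normc_ge0 //.
  by rewrite ltr_pdivrMr // mul1r => /ltW.
exists (Num.min d (e * t / (normc w + 1))).
  by rewrite lt_min d0 divr_gt0 // mulr_gt0.
move=> x px; rewrite lt_min => /andP[xd xe].
have rx := rd x px xd; have [x0 _] := andP px.
have rhoE : rho x * u 0 0 = s * phase x * (t%:C * (u 0 0 / (normc (u 0 0))%:C)
    + ((normc x)%:C * w + r x 0 0)).
  have mxZ c (M : 'cV[C]_2) : (c *: M) 0 0 = c * M 0 0 by rewrite mxE.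
  have mxD (M N : 'cV[C]_2) : (M + N) 0 0 = M 0 0 + N 0 0 by rewrite mxE.
  have leadE : lead mu delta u JXp 0 0 = t%:C * (u 0 0 / (normc (u 0 0))%:C).
    by rewrite /lead !mxE eqxx.
  have := congr1 (fun M : 'cV[C]_2 => M 0 0) (E_rho x px).
  rewrite E_exp // mxZ 2!mxD leadE [(_%:C *: what _ _ _ _ _) 0 0]mxZ.
  by rewrite [(rho x *: u) 0 0]mxZ addrA => <-.
have -> : (normc (u 0 0))%:C / (s * t%:C) * rho x - phase x =
    phase x * ((normc (u 0 0))%:C / (t%:C * u 0 0) * ((normc x)%:C * w + r x 0 0)).
  have -> : rho x = rho x * u 0 0 / u 0 0 by rewrite mulfK.
  by rewrite rhoE; field; rewrite tC nuC u00 s0.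
have phx : normc (phase x) = 1 by rewrite normc_phase // -normc_gt0.
rewrite normcM phx mul1r 2!normcM normcV normcM !normc_real ger0_norm ?normc_ge0 //.
rewrite gtr0_norm // invfM mulrCA divff ?mulr1 ?gt_eqF // mulrC.
rewrite ler_pdivrMr //; move: xe; rewrite ltr_pdivlMr // => xe.
apply: le_trans (ltW xe); rewrite mulrDr mulr1; apply: le_trans (le_normcD _ _) _.
rewrite normcM normc_real ger0_norm ?normc_ge0 //; apply: lerD => //.
exact: le_trans (normc_entry_le _ _) rx.
Qed.

End activation.

(** * Assembling a vector-valued network *)

Section assembly.
Variables (R : realType) (i0 k0 : nat) (ell : R) (rho : R[i] -> R[i]).
Notation C := R[i].
Variable B : set 'cV[C]_i0.

(** Concatenate the lists of neurons of the k0 outputs, each neuron feeding one output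
    only. *)
Lemma network_of_shallow (s : 'I_k0 -> seq (neuron R i0)) :
  (0 < k0)%N -> 0 < ell -> (forall k, admissible ell B (s k)) ->
  exists (j0 : nat) (a : 'M[C]_(j0, i0)) (b : 'cV[C]_j0) (c : 'M[C]_(k0, j0)),
    [/\ (0 < j0)%N, forall j z, B z -> pdisc ell (preact a b z j) &
        forall z k, network rho a b c z k 0 = shallow_sum rho (s k) z].
Proof.
move=> k0_gt0 ell0 sB.
(* A neuron with zero output weight keeps the network nonempty. *)
pose nu0 : neuron R i0 := ((0, 0), (ell / 2)%:C).
pose L := (Ordinal k0_gt0, nu0) :: [seq (k, nu) | k <- enum 'I_k0, nu <- s k].
have LB p : p \in L -> forall z, B z -> pdisc ell (neuron_input p.2 z).
  rewrite inE => /orP[/eqP -> z _|/allpairsPdep [k [nu [_ nus ->]]]]; last exact: sB nus.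
  rewrite /neuron_input /linear_form big1 => [|j _]; last by rewrite mxE mul0r.
  rewrite add0r /pdisc /mkset normc_real gtr0_norm ?divr_gt0 //=.
  by rewrite ltr_pdivrMr // ltr_pMr // ltr1n.
pose T := in_tuple L.
exists (size L), (\matrix_(j, i) (tnth T j).2.1.2 0 i), (\col_j (tnth T j).2.2),
  (\matrix_(k, j) if (tnth T j).1 == k then (tnth T j).2.1.1 else 0).
have preactE z j :
    preact (\matrix_(j, i) (tnth T j).2.1.2 0 i) (\col_j (tnth T j).2.2) z j =
    neuron_input (tnth T j).2 z.
  rewrite /preact /neuron_input mxE; congr (_ + _).
  by apply: eq_bigr => i _; rewrite mxE.
split=> // [j z Bz|z k].
  by rewrite preactE; apply: LB Bz; exact: mem_tnth.
rewrite mxE.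
transitivity (\sum_(p <- L) (if p.1 == k then p.2.1.1 else 0) * rho (neuron_input p.2 z)).
  by rewrite [RHS]big_tnth; apply: eq_bigr => j _; rewrite mxE preactE.
rewrite big_cons /= if_same mul0r add0r big_allpairs_dep /= big_enum /=.
rewrite (bigD1 k) //= eqxx [X in _ + X]big1 ?addr0 // => k' k'k.
by rewrite (negPf k'k) big1 // => nu _; rewrite mul0r.
Qed.

End assembly.

Section sup_norm.
Variables (R : realType) (n k : nat).
Notation C := R[i].

Lemma enorm_le (z : 'cV[C]_k) (e : R) : 0 <= e ->
  (forall j, normc (z j 0) <= e / k%:R) -> enorm z <= e.
Proof.
move=> e0 ze; rewrite -(@ler_pXn2r _ 2) ?nnegrE ?enorm_ge0 // enorm_sqr.
case: k z ze => [|m] z ze; first by rewrite big_ord0 sqr_ge0.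
have m0 : 0 < m.+1%:R :> R by rewrite ltr0n.
apply: (@le_trans _ _ (\sum_(j < m.+1) (e / m.+1%:R) ^+ 2)).
  apply: ler_sum => j _; apply: lerXn2r; rewrite ?nnegrE ?normc_ge0 ?divr_ge0 //.
rewrite sumr_const card_ord -(mulr_natr (_ ^+ 2)).
rewrite -[X in _ <= X ^+ 2](divfK (lt0r_neq0 m0)) [leRHS]exprMn.
apply: ler_wpM2l; first exact: sqr_ge0.
by rewrite expr2 ler_peMr ?ler1n // ltW.
Qed.

Lemma Linfty_norm_le (A : set 'cV[C]_n) (g : 'cV[C]_n -> 'cV[C]_k) (e : R) :
  0 <= e -> (forall z, A z -> enorm (g z) <= e) -> (Linfty_norm A g <= e%:E)%E.
Proof.
move=> e0 ge; rewrite /Linfty_norm unlock /=; case: ifP => _; last by rewrite lee_fin.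
apply/ess_supP; apply: aeW => z /=; rewrite patchE.
case: ifPn => [|_]; last by rewrite abse0 lee_fin.
by rewrite inE => /ge gz; rewrite gee0_abs ?lee_fin ?enorm_ge0.
Qed.

Lemma pdisc_open (r : R) : open (pdisc r).
Proof.
rewrite openE => x /andP[x0 xr]; apply/nbhs_normcP.
exists (Num.min (normc x) (r - normc x)); first by rewrite lt_min x0 subr_gt0.
move=> y; rewrite lt_min => /andP[xy1 xy2]; rewrite /pdisc /=.
have := normc_distl x y; rewrite ler_norml; lra.
Qed.

End sup_norm.

(** The activation function is continuous on the open punctured disc, being a component of
    the branch E divided by a constant, hence Borel once extended by 0; the extension
    does not change the network where all inputs are in the disc. *)

Section network_measurability.
Variables (R : realType) (ell : R) (rho : R[i] -> R[i]).
Notation C := R[i].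
Variables (E : C -> 'cV[C]_2) (u : 'cV[C]_2).
Hypotheses (u00 : u 0 0 != 0) (E_continuous : {within pdisc ell, continuous E}).
Hypothesis E_rho : forall x, pdisc ell x -> E x = rho x *: u.

Let rho0 (x : C) : C := if `[< pdisc ell x >] then rho x else 0.

Let measurable_rho0 d (T : measurableType d) (h : T -> C) :
  measurable_complex h -> measurable_complex (fun t => rho0 (h t)).
Proof.
move=> mh.
pose part (p : C -> R) (x : C) : R := if `[< pdisc ell x >] then p (E x 0 0) else 0.
have mpart (p : C -> R) : continuous p -> measurable_fun setT (part p \o h).
  move=> cp; apply: (measurable_continuous_open mh (@pdisc_open R ell)); last first.
    by move=> x nx; rewrite /part asboolF.
  have cpE : {within pdisc ell, continuous (fun x => p (E x 0 0))}.
    apply/subspace_continuousP => x px.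
    have /subspace_continuousP/(_ x px) cE := E_continuous.
    apply: (cvg_comp _ _ (cvg_comp _ _ cE (@entry_continuous R 2 0 _))); exact: cp.
  apply: subspace_eq_continuous cpE => x; rewrite inE => px.
  by rewrite /from_subspace /part asboolT.
have := measurable_complexZ (u 0 0)^-1
  (h := fun t => part (@complex.Re R) (h t) +i* part (@complex.Im R) (h t))
  (conj (mpart _ (@Re_continuous R)) (mpart _ (@Im_continuous R))).
congr measurable_complex; apply/funext => t; rewrite /part /rho0.
case: asboolP => [/E_rho ->|_]; last by rewrite (_ : 0 +i* 0 = 0) ?mulr0.
rewrite mxE; have -> (y : C) : complex.Re y +i* complex.Im y = y by case: y.
by rewrite mulrCA mulVf ?mulr1.
Qed.

Lemma network_measurable (i0 j0 k0 : nat) (D : set 'cV[C]_i0)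
    (a : 'M[C]_(j0, i0)) (b : 'cV[C]_j0) (c : 'M[C]_(k0, j0)) :
  (forall z, D z -> forall j, pdisc ell (preact a b z j)) ->
  measurable_fun D (network rho a b c).
Proof.
move=> Dp; apply: (@eq_measurable_fun _ _ _ _ D (network rho0 a b c)).
  move=> z; rewrite inE => Dz; apply/colP => k; rewrite !mxE.
  by apply: eq_bigr => j _; rewrite /rho0 asboolT //; exact: Dp.
apply: measurable_funTS; apply: measurable_column => k.
rewrite (_ : (fun z => _) =
    fun z => \sum_(j < j0) c k j * rho0 (preact a b z j)); last first.
  by apply/funext => z; rewrite mxE.
apply: measurable_complex_sum => j; apply: measurable_complexZ; apply: measurable_rho0.
apply: measurable_complexD; last exact: measurable_complex_cst.
by apply: measurable_complex_sum => i; apply: measurable_complexZ; exact: measurable_entry.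
Qed.

End network_measurability.

(** * Universal approximation with the injection-locking activation *)

Unset Implicit Arguments.
Theorem theorem18 (R : realType) (kappa gamma delta alpha mu : R)
  (kappa0 : 0 < kappa) (gamma0 : 0 < gamma) (delta0 : 0 < delta) (mu1 : 1 < mu)
  (uhat : 'cV[R[i]]_2) (uhat0 : uhat != 0)
  (uhat_lin : normc (uhat 0 0) = normc (uhat 1 0))
  (ell : R) (ell0 : 0 < ell)
  (Ej : mode -> R[i] -> 'cV[R[i]]_2)
  (Ej_continuous : forall j : mode, {within pdisc ell, continuous (Ej j)})
  (Ej_distinct : forall (j j' : mode) (lam : R[i]),
     pdisc ell lam -> j <> j' -> Ej j lam <> Ej j' lam)
  (P1 : forall lam : R[i], pdisc ell lam ->
     forall (E : 'cV[R[i]]_2) (N n : R),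
       equilibrium kappa gamma delta alpha mu (lam *: uhat) E N n <->
       exists j : mode, E = Ej j lam /\
         col2 N n = yfun mu delta (col2 (normc (E 0 0)) (normc (E 1 0))))
  (P2 : forall j : mode, exists r : R[i] -> 'cV[R[i]]_2,
     (forall lam : R[i], pdisc ell lam ->
        Ej j lam = (expi (- carg (1 +i* alpha)) * phase lam) *:
          (lead mu delta uhat j + (normc lam)%:C *: what mu delta alpha uhat j
           + r lam)) /\
     (enorm (r lam) / normc lam @[lam --> (0 : R[i])^'] --> (0 : R)))
  (P3 : forall j : mode, j = J0 \/ j = JXp \/ j = JXm ->
     forall lam : R[i], pdisc ell lam ->
       exists rhoj : R[i], Ej j lam = rhoj *: uhat)
  (rho : R[i] -> R[i])
  (rho_act : forall lam : R[i], pdisc ell lam -> Ej JXp lam = rho lam *: uhat)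
  (i0 k0 : nat) (i0_gt0 : (0 < i0)%N) (k0_gt0 : (0 < k0)%N)
  (rad : R) (rad0 : 0 < rad)
  (f : 'cV[R[i]]_i0 -> 'cV[R[i]]_k0)
  (f_continuous : {within cball rad, continuous f})
  (eps : R) (eps0 : 0 < eps) :
  exists (j0 : nat) (a : 'M[R[i]]_(j0, i0)) (b : 'cV[R[i]]_j0)
         (c : 'M[R[i]]_(k0, j0)),
    [/\ (0 < j0)%N,
        (\forall z \ae @lebesgue_Cn R i0,
           cball rad z -> forall j : 'I_j0, pdisc ell (preact a b z j)),
        (let D := [set z : 'cV[R[i]]_i0 |
                   cball rad z /\ forall j : 'I_j0, pdisc ell (preact a b z j)]
         in measurable D /\ measurable_fun D (network rho a b c)) &
        (Linfty_norm (cball rad) (fun z => network rho a b c z - f z)%R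
           <= eps%:E)%E].
Proof.
have u00 := linear_polarization_neq0 uhat0 uhat_lin.
have [r [E_exp r_o]] := P2 JXp.
have [k rho_phase] := activation_phase mu1 uhat0 uhat_lin E_exp r_o rho_act.
have f_entry (p : R[i] -> R) j : continuous p ->
    continuous_on (cball rad) (fun z => p (f z j 0)).
  move=> cp; apply/within_continuousP.
  apply: (@within_continuous_comp _ _ _ _ _ (fun w : 'cV[R[i]]_k0 => p (w j 0)) _
    f_continuous) => w _.
  exact: (continuous_comp (@entry_continuous R k0 j w) (cp _)).
have eps_k : 0 < eps / k0%:R by rewrite divr_gt0 // ltr0n.
have /choice[s sP] (j : 'I_k0) : exists s, admissible ell (cball rad) s /\
    forall z, cball rad z -> normc (shallow_sum rho s z - f z j 0) <= eps / k0%:R.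
  have [s sB sf] := shallow_universal ell0 (ltW rad0) rho_phase
    (f_entry _ j (@Re_continuous R)) (f_entry _ j (@Im_continuous R)) eps_k.
  by exists s.
have [j0 [a [b [c [j0_gt0 pre_in netE]]]]] :=
  network_of_shallow rho k0_gt0 ell0 (fun j => (sP j).1).
have netD : [set z : 'cV[R[i]]_i0 | cball rad z /\
    forall j : 'I_j0, pdisc ell (preact a b z j)] = cball rad.
  by apply/seteqP; split=> [z []//|z zB]; split=> // j; exact: pre_in.
exists j0, a, b, c; split=> //.
- by apply: aeW => z zB j; exact: pre_in.
- rewrite netD; split; first exact/cball_measurable/ltW.
  apply: (network_measurable u00 (Ej_continuous JXp) rho_act) => z zB j.
  exact: pre_in.
- apply: Linfty_norm_le; first exact: ltW.
  move=> z zB; apply: enorm_le; first exact: ltW.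
  move=> j; have -> : (network rho a b c z - f z) j 0 =
      shallow_sum rho (s j) z - f z j 0 by rewrite -netE !mxE.
  exact: (sP j).2.
Qed.
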